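(* Let $3\le k\le n$, with ground field $\mathbf C$. (i) The rational map $\psi$ from the moduli space of twisted $n$-gons in $\mathbf{CP}^2$ to the $(\mathbf x,\mathbf y)$-space (equivalently, to the moduli space of corrugated twisted $n$-gons in $\mathbf{CP}^{k-1}$) is $\binom k3$-to-one (over a generic point). (ii) The map $\psi$ conjugates $\bar F_k$ and $F_k$, that is, $\psi\circ\bar F_k=F_k\circ\psi$.
   Context: A twisted $n$-gon in $\mathbf{CP}^m$ is a sequence $V=(V_i)_{i\in\mathbf Z}$ with $V_{i+n}=M(V_i)$ for all $i$ and a fixed projective transformation $M$. Moduli spaces are taken modulo projective equivalence. Plane polygons: twisted $n$-gons in $\mathbf{CP}^2$ are assumed generic in the sense that for every $i$ no three of $V_i,V_{i+1},V_{i+k-1},V_{i+k}$ are collinear. The higher pentagram (skip $(k-2)$-diagonal) map $\bar F_k$ sends $V$ to the twisted $n$-gon in $\mathbf{CP}^2$ whose $i$th vertex is $(V_i,V_{i+k-1})\cap(V_{i+1},V_{i+k})$. The vertices of such a plane polygon can be lifted to vectors $\widetilde V_i\in\mathbf C^3$ so that $$\widetilde V_{i+k}=y_{i-1}\widetilde V_i+x_i\widetilde V_{i+1}+\widetilde V_{i+k-1}\quad\text{for all }i\qquad( * )$$ with $n$-periodic sequences $(x_i),(y_i)$ determined by the projective class of $V$; the map $\psi$ sends the class of $V$ to $(\mathbf x,\mathbf y)=(x_1,\dots,x_n,y_1,\dots,y_n)$. Corrugated polygons: a twisted $n$-gon $V$ in $\mathbf{CP}^{k-1}$ (every $k$ consecutive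 vertices spanning $\mathbf{CP}^{k-1}$) is corrugated if $V_i,V_{i+1},V_{i+k-1},V_{i+k}$ span a projective plane for every $i$. The projective classes of generic corrugated polygons (no three of these four vertices collinear) are parametrized by $n$-periodic sequences $(\mathbf x,\mathbf y)$ through a lift $\widetilde V_i\in\mathbf C^k$ satisfying the same recurrence $( * )$. The map $F_k$ sends a corrugated polygon $V$ to the twisted polygon whose $i$th vertex is $(V_i,V_{i+k-1})\cap(V_{i+1},V_{i+k})$; it induces a rational self-map of the $(\mathbf x,\mathbf y)$-space, also denoted $F_k$. *)

(* Defs.v *)
From HB Require Import structures.
From mathcomp Require Import all_boot all_order all_algebra.
From mathcomp Require Import boolp classical_sets functions cardinality reals.
From mathcomp Require Import complex.
From mathcomp Require Import mpoly.
Set Implicit Arguments.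
Unset Strict Implicit.
Unset Printing Implicit Defensive.
Import Order.TTheory GRing.Theory Num.Theory.
Local Open Scope ring_scope.

(* R[i], for R a realType, is the field of complex numbers.
   CP^(d-1) is modelled by the one-dimensional subspaces of C^d; the span of
   points is the sum of subspaces, the intersection of lines is their
   intersection, and projective transformations are the maps induced by
   injective endomorphisms of C^d. *)
Definition gon (R : realType) (d : nat) := int -> {vspace 'rV[R[i]]_d}.

Definition proj_equiv (R : realType) (d : nat) (V V' : gon R d) : Prop :=
  exists2 A : 'End('rV[R[i]]_d), lker A == 0%VS
    & forall i, V' i = (A @: V i)%VS.

Definition proj_class (R : realType) (d : nat) (V : gon R d) : set (gon R d) :=
  [set V' | proj_equiv V V']%classic.

Definition twisted (R : realType) (d n : nat) (V : gon R d) : Prop :=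
  (forall i, \dim (V i) = 1%N) /\
  exists2 M : 'End('rV[R[i]]_d), lker M == 0%VS
    & forall i, V (i + n%:Z) = (M @: V i)%VS.

Definition collinear (R : realType) (d : nat)
    (A B C : {vspace 'rV[R[i]]_d}) : bool :=
  (\dim (A + B + C)%VS <= 2)%N.

Definition no_three_collinear (R : realType) (d : nat)
    (A B C D : {vspace 'rV[R[i]]_d}) : bool :=
  [&& ~~ collinear A B C, ~~ collinear A B D,
      ~~ collinear A C D & ~~ collinear B C D].

Definition generic_gon (R : realType) (d k : nat) (V : gon R d) : Prop :=
  forall i, no_three_collinear
    (V i) (V (i + 1)) (V (i + k%:Z - 1)) (V (i + k%:Z)).

Definition plane_gon (R : realType) (k n : nat) (V : gon R 3) : Prop :=
  twisted n V /\ generic_gon k V.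

Definition corrugated (R : realType) (k n : nat) (V : gon R k) : Prop :=
  [/\ twisted n V,
      forall i : int, (\sum_(j < k) V (i + (j : nat)%:Z)%R)%VS = fullv
    & forall i : int, \dim (V i + V (i + 1)%R
                      + V (i + k%:Z - 1)%R + V (i + k%:Z)%R)%VS = 3%N].

Definition corrugated_gon (R : realType) (k n : nat) (V : gon R k) : Prop :=
  corrugated n V /\ generic_gon k V.

(* The common formula for \bar F_k (d = 3) and F_k (d = k) on polygons. *)
Definition pentagram (R : realType) (d k : nat) (V : gon R d) : gon R d :=
  fun i : int =>
    ((V i + V (i + k%:Z - 1)%R) :&: (V (i + 1)%R + V (i + k%:Z)%R))%VS.

(* A point (x_1, ..., x_n, y_1, ..., y_n); x_n is stored at index 0. *)
Definition xy_space (R : realType) (n : nat) : Type :=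
  ('rV[R[i]]_n * 'rV[R[i]]_n)%type.

Definition periodic (R : realType) (n : nat) (x : 'rV[R[i]]_n) (i : int) :
    R[i] :=
  if insub `|(i %% n%:Z)%Z|%N is Some j then x 0 j else 0.

Definition has_coords (R : realType) (d k n : nat) (V : gon R d)
    (xy : xy_space R n) : Prop :=
  exists W : int -> 'rV[R[i]]_d,
    (forall i, V i = <[W i]>%VS) /\
    (forall i, W (i + k%:Z) = periodic xy.2 (i - 1) *: W i
                            + periodic xy.1 i *: W (i + 1)
                            + W (i + k%:Z - 1)).

(* The coordinates of a generic plane or corrugated polygon exist and are
   unique (its lift is unique up to a global scalar), and they depend only on
   its projective class; the default value 0 is not attained by any generic
   polygon, whose coordinates are all nonzero. *)
Definition psi (R : realType) (d k n : nat) (V : gon R d) : xy_space R n :=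
  xget (0, 0) [set xy | has_coords k V xy]%classic.

(* The self-map of the (x, y)-space induced by the map F_k on corrugated
   polygons; its value is (0, 0) where that rational map is not defined. *)
Definition corr_map (R : realType) (k n : nat) (xy : xy_space R n) :
    xy_space R n :=
  xget (0, 0) [set xy' | exists V : gon R k,
    [/\ corrugated_gon n V, has_coords k V xy,
        corrugated_gon n (pentagram k V)
      & has_coords k (pentagram k V) xy']]%classic.

Definition xy_eval (R : realType) (n : nat) (P : {mpoly R[i][n + n]})
    (xy : xy_space R n) : R[i] :=
  P.@[fun j => row_mx xy.1 xy.2 0 j].

Definition psi_fiber (R : realType) (k n : nat) (xy : xy_space R n) :
    set (set (gon R 3)) :=
  [set proj_class V | V in
    [set V : gon R 3 | plane_gon k n V /\ psi k n V = xy]]%classic.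

(* Main.v *)
Require Import Defs.
From HB Require Import structures.
From mathcomp Require Import all_boot all_order all_algebra fingroup perm.
From mathcomp Require Import boolp classical_sets functions cardinality reals.
From mathcomp Require Import complex mpoly.
From mathcomp Require Import zify ring.
Set Implicit Arguments.
Unset Strict Implicit.
Unset Printing Implicit Defensive.
Import Order.TTheory GRing.Theory Num.Theory.
Local Open Scope ring_scope.

(* A plane polygon with coordinates (x, y) is a solution W of the order k
   recurrence with values in C^3.  All solutions are W_i = u_i B, where u is
   the fundamental solution with values in C^k and B is a k x 3 matrix; with
   u_(i+n) = u_i T, such a W is twisted exactly when T B = B N for some 3 x 3
   matrix N.  When T has k distinct eigenvalues, the column space of B is
   spanned by three of its k eigenvectors, hence the fibre of psi has
   binomial(k, 3) points, provided that every choice of three eigenvectors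
   gives a generic polygon.

   That proviso is a product of determinants in the entries of T and in its
   eigenvalues; its norm over all orderings of the eigenvalues is symmetric,
   hence a polynomial in the coefficients of the characteristic polynomial of T,
   i.e. in (x, y).  It is not the zero polynomial because it does not vanish at
   x = 0, y = t for a suitable constant t: there the solutions are spanned by
   i |-> mu^i with mu^(k-1) (mu - 1) = t.

   For the conjugacy, y_(i-1) W_i + W_(i+k-1) = W_(i+k) - x_i W_(i+1) lies on
   both diagonals, so it lifts the pentagram vertex in any dimension, and it
   satisfies a recurrence whose coefficients are given by the same formula for
   plane and for corrugated polygons. *)

(** * Symmetric functions of the eigenvalues *)

Lemma mpoly_rmorphism_ext (A B : comNzRingType) k
    (f g : {rmorphism {mpoly A[k]} -> B}) :
  (forall c, f c%:MP = g c%:MP) -> (forall i, f 'X_i = g 'X_i) -> f =1 g.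
Proof.
move=> fgC fgX p; rewrite [p]mpolyE !raddf_sum /=; apply: eq_bigr => m _.
rewrite -mul_mpolyC !rmorphM /= fgC mpolyXE_id !rmorph_prod /=.
by congr (_ * _); apply: eq_bigr => i _; rewrite !rmorphXn /= fgX.
Qed.

(** The product of all permuted copies of [G] is symmetric, hence a polynomial in the elementary
    symmetric functions, and these specialize to signed coefficients of the characteristic
    polynomial. [P] is chosen before [phi], so one [P] serves every specialization of [A]. *)
Lemma norm_at_eigenvalues (A : idomainType) k (T : 'M[A]_k) (G : {mpoly A[k]}) :
  exists P : A, forall (F : idomainType) (phi : {rmorphism A -> F})
    (lam : 'I_k -> F),
    char_poly (map_mx phi T) = \prod_a ('X - (lam a)%:P) ->
    phi P = \prod_(s : 'S_k) mmap phi (fun a => lam (s a)) G.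
Proof.
have symH : \prod_(s : 'S_k) msym s G \is symmetric.
  apply/issymP => t; rewrite rmorph_prod /=.
  rewrite [RHS](reindex_inj (mulIg t)) /=.
  by apply: eq_bigr => s _; rewrite -msymMm.
have [q [qE _]] := sym_fundamental symH.
(* The sign turns the coefficient of degree [k - i - 1] into the elementary symmetric function of
   degree [i + 1] of the eigenvalues. *)
pose c (i : 'I_k) : A := (-1) ^+ i.+1 * (char_poly T)`_(k - i.+1).
exists (meval c q) => F phi lam lamE.
have -> : \prod_(s : 'S_k) mmap phi (fun a => lam (s a)) G =
    mmap phi lam (\prod_(s : 'S_k) msym s G).
  rewrite rmorph_prod /=; apply: eq_bigr => s _.
  rewrite -[RHS]/((mmap phi lam \o msym s) G).
  apply: mpoly_rmorphism_ext => [d|i] /=.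
    by rewrite /msym !mmapC.
  by rewrite /msym !(mmapX, mmap1U).
rewrite -qE -[LHS]/((phi \o meval c) q).
rewrite -[RHS]/((mmap phi lam \o comp_mpoly _) q).
apply: mpoly_rmorphism_ext => [d|i] /=.
  by rewrite mevalC comp_mpolyC mmapC.
rewrite mevalXU comp_mpolyXU -tnth_nth tnth_mktuple /c.
rewrite rmorphM rmorph_sign -coef_map map_char_poly lamE.
have := @mroots_coeff F k [tuple lam a | a < k] (lift ord0 i).
rewrite big_tuple.
have -> : tnth [tuple lam a | a < k] = lam.
  by apply/funext => a; rewrite tnth_mktuple.
have -> : (k - lift ord0 i = k - i.+1)%N by [].
move=> ->; rewrite mulrA -exprD addnn -mul2n exprM sqrrN !expr1n mul1r.
rewrite /mesym !raddf_sum /=; apply: eq_bigr => h _.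
rewrite !rmorph_prod /=; apply: eq_bigr => a _.
by rewrite mevalXU mmapX mmap1U.
Qed.

(** * The linear recurrence *)

Lemma int_ind2 (P : int -> Prop) :
  P 0 -> (forall i, P i -> P (i + 1)) -> (forall i, P (i + 1) -> P i) ->
  forall i, P i.
Proof.
move=> P0 PS PP [m|m].
  elim: m => [//|m IHm]; have -> : Posz m.+1 = Posz m + 1 by lia.
  exact: PS.
elim: m => [|m IHm]; first by apply: PP.
by apply: PP; have -> : Negz m.+1 + 1 = Negz m by lia.
Qed.

Lemma int_rec (X : Type) (step inv : int -> X -> X) (x0 : X) :
  (forall i, cancel (inv i) (step i)) ->
  exists2 st : int -> X, st 0 = x0 & forall i, st (i + 1) = step i (st i).
Proof.
move=> invK.
exists (fun i => match i with
  | Posz m => iteri m (fun j => step j%:Z) x0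
  | Negz m => iteri m.+1 (fun j => inv (Negz j)) x0 end) => // -[m|m].
  by have -> : Posz m + 1 = Posz m.+1 by lia.
rewrite /= invK; case: m => [//|m].
by have -> : Negz m.+1 + 1 = Negz m by lia.
Qed.

(** Coefficients are arbitrary sequences, so that shifts and pentagram images fit; values lie in any
    module, so that a solution can be mapped linearly. *)
Definition linrec (F : fieldType) (E : lmodType F) (k : nat) (x y : int -> F)
    (W : int -> E) :=
  forall i, W (i + k%:Z) =
    y (i - 1) *: W i + x i *: W (i + 1) + W (i + k%:Z - 1).

Section LinearRecurrence.

Variables (F : fieldType) (k : nat) (x y : int -> F).
Hypotheses (hk : (2 < k)%N) (y_neq0 : forall i, y i != 0).

(** Agreement on [k] consecutive indices propagates forwards by the recurrence and backwards because
    each [y i] is invertible. *)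
Lemma linrec_uniq (E : lmodType F) (W W' : int -> E) :
  linrec k x y W -> linrec k x y W' ->
  (forall j, (j < k)%N -> W j%:Z = W' j%:Z) -> W =1 W'.
Proof.
move=> recW recW' eqW.
suff H : forall i j, (j < k)%N -> W (i + j%:Z) = W' (i + j%:Z).
  by move=> i; have := H i 0%N; rewrite addr0; apply; lia.
apply: int_ind2 => [j|i IH j|i IH [|j]] jk.
- by rewrite add0r eqW.
- have [jk'|jk'] := ltnP j.+1 k.
    by rewrite (_ : i + 1 + j%:Z = i + j.+1%:Z); [apply: IH | lia].
  have -> : i + 1 + j%:Z = i + k%:Z by lia.
  rewrite recW recW'; have := IH 0%N; rewrite addr0 => -> //; last by lia.
  have -> : i + k%:Z - 1 = i + k.-1%:Z by lia.
  by rewrite (IH 1%N) ?(IH k.-1) //; lia.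
- rewrite addr0; apply: (scalerI (y_neq0 (i - 1))).
  have e (V : int -> E) : linrec k x y V -> y (i - 1) *: V i =
      V (i + 1 + k.-1%:Z) - x i *: V (i + 1 + 0%:Z) - V (i + 1 + k.-2%:Z).
    move=> recV; have -> : i + 1 + k.-1%:Z = i + k%:Z by lia.
    have -> : i + 1 + k.-2%:Z = i + k%:Z - 1 by lia.
    by rewrite recV !addr0 [RHS]addrAC !addrK.
  by rewrite !e // !IH //; lia.
- have -> : i + j.+1%:Z = i + 1 + j%:Z by lia.
  by apply: IH; lia.
Qed.

Lemma linrec_exists (E : lmodType F) (f : nat -> E) :
  exists2 W : int -> E, linrec k x y W & forall j, (j < k)%N -> W j%:Z = f j.
Proof.
(* The state is a window of [k] consecutive values stored as a function on [nat]. Entries of index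
   at least [k] are left untouched, so that [inv] is a right inverse of [step] on whole
   functions. *)
pose step (i : int) (g : nat -> E) j :=
  if (j.+1 < k)%N then g j.+1 else
  if j.+1 == k then y (i - 1) *: g 0%N + x i *: g 1%N + g k.-1 else g j.
pose inv (i : int) (g : nat -> E) j :=
  if j is j'.+1 then if (j < k)%N then g j' else g j else
  (y (i - 1))^-1 *: (g k.-1 - x i *: g 0%N - g k.-2).
have invK i : cancel (inv i) (step i).
  move=> g; apply/funext => j; rewrite /step /inv /=.
  have [//|kj] := ltnP j.+1 k.
  have [jk|jk] := eqVneq j.+1 k; last first.
    by case: j kj jk => [|j] kj jk; [lia | case: ifP => //; lia].
  have -> : (1 < k)%N by lia.
  rewrite scalerA divff ?scale1r //.
  have -> : k.-1 = k.-2.+1 by lia.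
  have -> : (k.-2.+1 < k)%N by lia.
  rewrite (addrAC _ (- g k.-2)) subrK subrK.
  by congr g; lia.
have [st st0 stS] := int_rec f invK.
(* Entry [j] of the window at [i] is the solution at [i + j]. *)
have stE j : (j < k)%N -> forall i, st i j = st (i + j%:Z) 0%N.
  elim: j => [|j IHj] jk i; first by rewrite addr0.
  have := IHj (ltnW jk) (i + 1); rewrite stS /step jk => ->.
  by congr (st _ 0%N); lia.
exists (fun i => st i 0%N) => [i|j jk]; last by rewrite -[j%:Z]add0r -stE // st0.
have -> : i + k%:Z = i + 1 + k.-1%:Z by lia.
rewrite -stE ?stS /step; last by lia.
have -> : (k.-1.+1 < k)%N = false by lia.
have -> : k.-1.+1 == k by lia.
have -> : i + 1 + k.-1%:Z - 1 = i + k.-1%:Z by lia.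
have -> : (1 < k)%N by lia.
by rewrite -stE; [|lia].
Qed.

End LinearRecurrence.

Lemma linrec_map (F : fieldType) (E E' : lmodType F) (k : nat) (x y : int -> F)
    (f : {linear E -> E'}) (W : int -> E) :
  linrec k x y W -> linrec k x y (fun i => f (W i)).
Proof. by move=> recW i; rewrite recW !linearD !linearZ. Qed.

Lemma linrec_shift (F : fieldType) (E : lmodType F) (k : nat) (x y : int -> F)
    (m : int) (W : int -> E) : linrec k x y W ->
  linrec k (fun i => x (i + m)) (fun i => y (i + m)) (fun i => W (i + m)).
Proof.
move=> recW i.
rewrite (addrAC i k%:Z m) recW (addrAC i (- 1) m) (addrAC i 1 m).
by rewrite (addrAC (i + k%:Z) (- 1) m) (addrAC i k%:Z m).
Qed.

(** * Independent triples and collinearity *)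

Definition indep3 (F : fieldType) (E : lmodType F) (a b c : E) :=
  forall al be ga : F, al *: a + be *: b + ga *: c = 0 ->
  [/\ al = 0, be = 0 & ga = 0].

Lemma indep3_neq0 (F : fieldType) (E : lmodType F) (a b c : E) :
  indep3 a b c -> [/\ a != 0, b != 0 & c != 0].
Proof.
move=> abc; split; apply/eqP => z.
- by have [] := abc 1 0 0; rewrite ?z ?scale1r ?scale0r ?addr0 // => /eqP; rewrite oner_eq0.
- by have [] := abc 0 1 0; rewrite ?z ?scale1r ?scale0r ?addr0 // => _ /eqP; rewrite oner_eq0.
- by have [] := abc 0 0 1; rewrite ?z ?scale1r ?scale0r ?addr0 // => _ _ /eqP; rewrite oner_eq0.
Qed.

Lemma indep3_inj (F : fieldType) (E E' : lmodType F) (f : {linear E -> E'})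
    (a b c : E) : injective f -> indep3 a b c -> indep3 (f a) (f b) (f c).
Proof.
move=> fI H al be ga; rewrite -!linearZ -!linearD -[RHS](linear0 f).
by move/fI/H.
Qed.

Lemma free3P (F : fieldType) (E : vectType F) (a b c : E) :
  free [:: a; b; c] <-> indep3 a b c.
Proof.
split=> [/(@freeP _ _ _ [tuple a; b; c]) H al be ga e | H].
  have := H (fun i => [:: al; be; ga]`_i).
  rewrite !big_ord_recl big_ord0 /= addr0 addrA => /(_ e) H0.
  by split; [apply: (H0 ord0)|apply: (H0 (lift ord0 ord0))
            |apply: (H0 (lift ord0 (lift ord0 ord0)))].
apply/(@freeP _ _ _ [tuple a; b; c]) => f.
rewrite !big_ord_recl big_ord0 /= addr0 addrA => /H[f0 f1 f2] i.
case: i => [[|[|[|//]]] hi].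
- by rewrite -[RHS]f0; congr f; apply: val_inj.
- by rewrite -[RHS]f1; congr f; apply: val_inj.
- by rewrite -[RHS]f2; congr f; apply: val_inj.
Qed.

Lemma dim_lines3 (F : fieldType) (E : vectType F) (a b c : E) :
  (\dim (<[a]> + <[b]> + <[c]>) <= 2)%N = ~~ free [:: a; b; c].
Proof.
have -> : (<[a]> + <[b]> + <[c]> = <<[:: a; b; c]>>)%VS.
  by rewrite !span_cons span_nil addv0 addvA.
rewrite /free; have := dim_span [:: a; b; c] => /= ?.
by apply/idP/idP; lia.
Qed.

Lemma collinearPn (R : realType) d (a b c : 'rV[R[i]]_d) :
  ~~ collinear <[a]>%VS <[b]>%VS <[c]>%VS <-> indep3 a b c.
Proof. by rewrite /collinear dim_lines3 negbK free3P. Qed.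

Definition rows3 (A : comNzRingType) d (a b c : 'rV[A]_d) : 'M[A]_(3, d) :=
  \matrix_(r < 3) nth a [:: a; b; c] r.

Lemma rows3M (A : comNzRingType) d d' (a b c : 'rV[A]_d) (B : 'M_(d, d')) :
  rows3 a b c *m B = rows3 (a *m B) (b *m B) (c *m B).
Proof.
by apply/row_matrixP => -[[|[|[|//]]] hr]; rewrite row_mul !rowK.
Qed.

Lemma map_rows3 (A A' : comNzRingType) (f : {rmorphism A -> A'}) d
    (a b c : 'rV[A]_d) :
  map_mx f (rows3 a b c) = rows3 (map_mx f a) (map_mx f b) (map_mx f c).
Proof.
by apply/row_matrixP => -[[|[|[|//]]] hr]; rewrite -map_row !rowK.
Qed.

Lemma row_free_rows3P (F : fieldType) d (a b c : 'rV[F]_d) :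
  row_free (rows3 a b c) <-> indep3 a b c.
Proof.
have e (v : 'rV_3) : v *m rows3 a b c =
    v 0 ord0 *: a + v 0 (lift ord0 ord0) *: b + v 0 (lift ord0 (lift ord0 ord0)) *: c.
  by rewrite mulmx_sum_row !big_ord_recl big_ord0 addr0 !rowK addrA.
split=> [H al be ga abc0|H].
  pose v : 'rV_3 := \row_i [:: al; be; ga]`_i.
  have : v *m rows3 a b c == 0 by rewrite e !mxE /= abc0.
  rewrite mulmx_free_eq0 // => /eqP/rowP v0.
  by split; [have := v0 ord0|have := v0 (lift ord0 ord0)
            |have := v0 (lift ord0 (lift ord0 ord0))]; rewrite !mxE.
apply: inj_row_free => v; rewrite e => /H[v0 v1 v2].
apply/rowP => -[[|[|[|//]]] hi]; rewrite !mxE.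
- by rewrite -[RHS]v0; congr (v 0 _); apply: val_inj.
- by rewrite -[RHS]v1; congr (v 0 _); apply: val_inj.
- by rewrite -[RHS]v2; congr (v 0 _); apply: val_inj.
Qed.

Lemma det_rows3P (F : fieldType) (a b c : 'rV[F]_3) :
  \det (rows3 a b c) != 0 <-> indep3 a b c.
Proof. by rewrite -row_free_rows3P row_free_unit unitmxE unitfE. Qed.

(** * The pentagram map on lifts *)

Section Combination.

Variables (F : fieldType) (d : nat) (a b c : 'rV[F]_d) (x y : F).
Let e := y *: a + x *: b + c.

Lemma indep3_combE al be ga ka :
  al *: a + be *: b + ga *: c + ka *: e =
  (al + ka * y) *: a + (be + ka * x) *: b + (ga + ka) *: c.
Proof. by apply/rowP => j; rewrite !mxE; ring. Qed.

(** Here [e] plays the lift of the fourth vertex. It may replace [a], [b] or [c] because its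
    coefficients there, [y], [x] and 1, are nonzero. *)
Lemma indep3_comb : indep3 a b c -> x != 0 -> y != 0 ->
  [/\ indep3 a b e, indep3 a c e & indep3 b c e].
Proof.
move=> abc x0 y0; split=> al be ga.
- have := indep3_combE al be 0 ga; rewrite scale0r addr0 => -> /abc[].
  rewrite add0r => + + g0; rewrite g0 !mul0r !addr0 => -> ->.
  by split.
- have := indep3_combE al 0 be ga; rewrite scale0r addr0 => -> /abc[].
  rewrite add0r => + /eqP; rewrite mulf_eq0 (negPf x0) orbF => + /eqP g0.
  by rewrite g0 !mul0r !addr0 => -> ->; split.
- have := indep3_combE 0 al be ga; rewrite scale0r add0r => -> /abc[].
  rewrite add0r => /eqP; rewrite mulf_eq0 (negPf y0) orbF => /eqP g0.
  by rewrite g0 !mul0r !addr0 => -> ->; split.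
Qed.

Lemma indep3_comb_neq0 : indep3 a c e -> indep3 b c e -> x != 0 /\ y != 0.
Proof.
move=> ace bce; split; apply/eqP => z.
- have := ace (- y) (- 1) 1; rewrite /e z => -[|_ _ /eqP]; rewrite ?oner_eq0 //.
  by apply/rowP => j; rewrite !mxE; ring.
- have := bce (- x) (- 1) 1; rewrite /e z => -[|_ _ /eqP]; rewrite ?oner_eq0 //.
  by apply/rowP => j; rewrite !mxE; ring.
Qed.

End Combination.

Section Pentagram.

Variables (F : fieldType) (d k : nat) (x y : int -> F) (W : int -> 'rV[F]_d).
Hypothesis recW : linrec k x y W.

Let s i := x i + y i.

Definition pent_lift (i : int) : 'rV[F]_d := y (i - 1) *: W i + W (i + k%:Z - 1).
(** [pent_x] and [pent_y] are the coordinates of the image polygon; they involve only [x] and [y],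
    not the dimension [d]. *)
Definition pent_x (i : int) : F := x i * (s (i + k%:Z - 1) / s i).
Definition pent_y (i : int) : F := y (i + 1) * (s (i + k%:Z) / s (i + 1)).

Lemma pent_liftE i : pent_lift i = W (i + k%:Z) - x i *: W (i + 1).
Proof. by rewrite recW /pent_lift; apply/rowP => j; rewrite !mxE; ring. Qed.

Lemma pent_lift1 i : pent_lift (i + 1) = y i *: W (i + 1) + W (i + k%:Z).
Proof. by rewrite /pent_lift; congr (y _ *: _ + W _); lia. Qed.

(** Eliminating [W (i + 1)] between two consecutive image lifts recovers an original vertex. This
    yields the recurrence of the image, and later shows that the image lifts still span. *)
Lemma pent_lift_combE i :
  y i *: pent_lift i + x i *: pent_lift (i + 1) = s i *: W (i + k%:Z).
Proof.
by rewrite pent_liftE pent_lift1 /s; apply/rowP => j; rewrite !mxE; ring.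
Qed.

Lemma pent_lift_diff i : pent_lift (i + k%:Z) =
  s (i + k%:Z - 1) *: W (i + k%:Z) + pent_lift (i + k%:Z - 1).
Proof.
rewrite (pent_liftE (i + k%:Z - 1)) /pent_lift /s.
have -> : i + k%:Z - 1 + k%:Z = i + k%:Z + k%:Z - 1 by lia.
have -> : i + k%:Z - 1 + 1 = i + k%:Z by lia.
by apply/rowP => j; rewrite !mxE; ring.
Qed.

Lemma linrec_pent : (forall i, s i != 0) -> linrec k pent_x pent_y pent_lift.
Proof.
move=> s0 i; rewrite pent_lift_diff; congr (_ + _).
rewrite /pent_y /pent_x !subrK.
have -> : i - 1 + k%:Z = i + k%:Z - 1 by lia.
have -> : s (i + k%:Z - 1) = s (i + k%:Z - 1) / s i * s i.
  by rewrite divfK.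
rewrite -scalerA -pent_lift_combE mulfK // scalerDr !scalerA.
by rewrite (mulrC (y i)) (mulrC (x i)).
Qed.

(** When [s i] is nonzero, the first two image lifts span the same plane as [W (i + 1)] and
    [W (i + k)], and the third is [W (i + 2k - 1)] modulo [W (i + k)]. This is the origin of the
    second determinant in [genericity]. *)
Lemma indep3_pent i : s i != 0 -> 
  indep3 (W (i + 1)) (W (i + k%:Z)) (W (i + k%:Z + k%:Z - 1)) ->
  indep3 (pent_lift i) (pent_lift (i + 1)) (pent_lift (i + k%:Z - 1)).
Proof.
move=> s0 H al be ga.
rewrite pent_lift1 (pent_liftE i) (pent_liftE (i + k%:Z - 1)).
have -> : i + k%:Z - 1 + k%:Z = i + k%:Z + k%:Z - 1 by lia.
have -> : i + k%:Z - 1 + 1 = i + k%:Z by lia.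
set Q := W (i + k%:Z); set P := W (i + 1); set R := W _.
have -> : al *: (Q - x i *: P) + be *: (y i *: P + Q) +
    ga *: (R - x (i + k%:Z - 1) *: Q) =
  (be * y i - al * x i) *: P + (al + be - ga * x (i + k%:Z - 1)) *: Q + ga *: R.
  by apply/rowP => j; rewrite !mxE; ring.
move=> /H[e1 e2 g0]; rewrite g0 mul0r subr0 in e2.
have be_al : be = - al by apply/eqP; rewrite -addr_eq0 addrC e2.
move: e1; rewrite be_al mulNr -opprD -mulrDr addrC => /eqP.
rewrite oppr_eq0 mulf_eq0 -/(s i) (negPf s0) orbF => /eqP a0.
by rewrite a0 oppr0.
Qed.

(** A vector on both diagonals gives a linear relation between three independent lifts, which forces
    it to be a multiple of [pent_lift i]. *)
Lemma pent_line i : indep3 (W i) (W (i + 1)) (W (i + k%:Z - 1)) ->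
  ((<[W i]> + <[W (i + k%:Z - 1)]>) :&: (<[W (i + 1)]> + <[W (i + k%:Z)]>) =
   <[pent_lift i]>)%VS.
Proof.
move=> H; apply/vspaceP => v; rewrite memv_cap; apply/andP/idP.
  case=> /memv_addP[_ /vlineP[al ->] [_ /vlineP[be ->] ->]].
  case/memv_addP=> _ /vlineP[ga ->] [_ /vlineP[de ->]].
  rewrite recW => e.
  have := H (al - de * y (i - 1)) (- ga - de * x i) (be - de).
  case=> [|/eqP]; last first.
    rewrite subr_eq0 => /eqP -> _ /eqP; rewrite subr_eq0 => /eqP ->.
    by apply/vlineP; exists de; rewrite /pent_lift scalerDr scalerA.
  move/eqP: e; rewrite -subr_eq0 => /eqP e; rewrite -[RHS]e.
  by apply/rowP => j; rewrite !mxE; ring.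
move=> /vlineP[t ->]; split.
  by rewrite memvZ // memv_add // ?memv_line // memvZ // memv_line.
rewrite memvZ // pent_liftE addrC memv_add // ?memv_line //.
by rewrite memvN memvZ // memv_line.
Qed.

End Pentagram.

Lemma vline_eqP (F : fieldType) (E : vectType F) (a b : E) : b != 0 ->
  <[a]>%VS = <[b]>%VS -> exists2 c, c != 0 & b = c *: a.
Proof.
move=> b0 ab; have /vlineP[c bE] : b \in <[a]>%VS by rewrite ab memv_line.
by exists c => //; apply: contraNneq b0 => c0; rewrite bE c0 scale0r.
Qed.

(* Comparing the two recurrences, the ratio c of the lifts satisfies
   c_(i+k) = c_(i+k-1), so it is constant. *)
Lemma lift_uniq (F : fieldType) d (k : nat) (x y x' y' : int -> F)
    (W W' : int -> 'rV[F]_d) :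
  linrec k x y W -> linrec k x' y' W' ->
  (forall i, indep3 (W i) (W (i + 1)) (W (i + k%:Z - 1))) ->
  (forall i, W' i != 0) -> (forall i, <[W i]>%VS = <[W' i]>%VS) ->
  [/\ exists2 c, c != 0 & forall i, W' i = c *: W i, x =1 x' & y =1 y'].
Proof.
move=> recW recW' ind W'0 eqW.
have /choice[c cP] i : exists c, c != 0 /\ W' i = c *: W i.
  by have [c] := vline_eqP (W'0 i) (eqW i); exists c.
have key i : [/\ c (i + k%:Z) = c (i + k%:Z - 1),
    c (i + k%:Z) * y (i - 1) = y' (i - 1) * c i
  & c (i + k%:Z) * x i = x' i * c (i + 1)].
  have := recW' i; rewrite (cP (i + k%:Z)).2 (cP i).2 (cP (i + 1)).2.
  rewrite (cP (i + k%:Z - 1)).2 recW => e.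
  have [|e1 e2 e3] := ind i (c (i + k%:Z) * y (i - 1) - y' (i - 1) * c i)
    (c (i + k%:Z) * x i - x' i * c (i + 1)) (c (i + k%:Z) - c (i + k%:Z - 1)).
    move/eqP: e; rewrite -subr_eq0 => /eqP e; rewrite -[RHS]e.
    by apply/rowP => j; rewrite !mxE; ring.
  by split; apply/eqP; rewrite -subr_eq0; apply/eqP.
have cS i : c (i + 1) = c i.
  have [+ _ _] := key (i + 1 - k%:Z).
  by rewrite subrK addrK.
have cC : forall i, c i = c 0.
  by apply: int_ind2 => // i; rewrite cS.
have c0 : c 0 != 0 := (cP 0).1.
split; first by exists (c 0) => // i; rewrite -(cC i) (cP i).2.
- move=> i; have [_ _] := key i; rewrite !cC mulrC => /mulIf; exact.
- move=> i; have [_ + _] := key (i + 1); rewrite !cC addrK mulrC => /mulIf; exact.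
Qed.

(** * Lifts of twisted polygons *)

Section Periodic.

Variables (R : realType) (n : nat) (hn : (0 < n)%N).

Lemma residue_subproof (i : int) : (`|(i %% n%:Z)%Z| < n)%N.
Proof. by have := @ltz_mod i n%:Z; have := @modz_ge0 i n%:Z; lia. Qed.

Definition residue (i : int) : 'I_n := Ordinal (residue_subproof i).

Lemma periodicE (x : 'rV[R[i]]_n) i : periodic x i = x 0 (residue i).
Proof.
rewrite /periodic; case: insubP => [j _ jE|].
  by congr (x 0 _); apply: val_inj.
by rewrite (residue_subproof i).
Qed.

Lemma residueD i : residue (i + n%:Z) = residue i.
Proof. by apply: val_inj; rewrite /= modzDr. Qed.

Lemma residue_nat (j : 'I_n) : residue (j : nat)%:Z = j.
Proof. by apply: val_inj; rewrite /= modz_nat absz_nat modn_small. Qed.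

Lemma periodicD (x : 'rV[R[i]]_n) i : periodic x (i + n%:Z) = periodic x i.
Proof. by rewrite !periodicE residueD. Qed.

Lemma shiftM_eq (T : Type) (f : int -> T) : (forall i, f (i + n%:Z) = f i) ->
  forall i q, f (i + q * n%:Z) = f i.
Proof.
move=> fn i; apply: int_ind2 => [|q IH|q IH].
- by rewrite mul0r addr0.
- by rewrite mulrDl mul1r addrA fn.
- by rewrite -IH mulrDl mul1r addrA fn.
Qed.

Lemma periodic_row (f : int -> R[i]) : (forall i, f (i + n%:Z) = f i) ->
  periodic (\row_(j < n) f (j : nat)%:Z) =1 f.
Proof.
move=> fn i; rewrite periodicE mxE [in RHS](divz_eq i n%:Z) addrC shiftM_eq //.
by congr f; rewrite /= gez0_abs // modz_ge0 //; lia.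
Qed.

Lemma periodic_inj (x x' : 'rV[R[i]]_n) : periodic x =1 periodic x' -> x = x'.
Proof.
move=> e; apply/rowP => j; have := e (j : nat)%:Z.
by rewrite !periodicE residue_nat.
Qed.

End Periodic.

Section Lift.

Variables (R : realType) (d k n : nat) (V : gon R d).
Variables (W : int -> 'rV[R[i]]_d) (x y : int -> R[i]).
Hypotheses (VE : forall i, V i = <[W i]>%VS) (recW : linrec k x y W).

(** The fourth vertex is the combination given by the recurrence, so genericity amounts to
    independence of the other three lifts and nonvanishing of the coefficients; [lift_generic] is
    the converse. *)
Lemma generic_lift : generic_gon k V ->
  [/\ forall i, indep3 (W i) (W (i + 1)) (W (i + k%:Z - 1)),
      forall i, x i != 0 & forall i, y i != 0].
Proof.
move=> gV.
have H i : [/\ indep3 (W i) (W (i + 1)) (W (i + k%:Z - 1)),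
    x i != 0 & y (i - 1) != 0].
  have := gV i; rewrite /no_three_collinear !VE => /and4P[].
  move=> /collinearPn h1 _ /collinearPn + /collinearPn.
  by rewrite recW => h2 h3; have [] := indep3_comb_neq0 h2 h3.
split=> i; have [h1 h2 h3] := H i => //.
by have [_ _] := H (i + 1); rewrite addrK.
Qed.

Lemma lift_generic : (forall i, indep3 (W i) (W (i + 1)) (W (i + k%:Z - 1))) ->
  (forall i, x i != 0) -> (forall i, y i != 0) -> generic_gon k V.
Proof.
move=> ind x0 y0 i; rewrite /no_three_collinear !VE.
have [h1 h2 h3] := indep3_comb (ind i) (x0 i) (y0 (i - 1)).
rewrite [W (i + k%:Z)]recW; apply/and4P.
by split; apply/collinearPn; [exact: ind|exact: h1|exact: h2|exact: h3].
Qed.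

(** The shift of [W] by [n] and the image of [W] under [M] lift the same polygon and both satisfy a
    recurrence. By [lift_uniq] they differ by a constant, absorbed into [N], and the coefficients
    are periodic. *)
Lemma twisted_lift : twisted n V -> generic_gon k V ->
  [/\ exists2 N, N \in unitmx & forall i, W (i + n%:Z) = W i *m N,
      forall i, x (i + n%:Z) = x i & forall i, y (i + n%:Z) = y i].
Proof.
move=> [_ [M /lker0P Minj MV]] gV; have [ind x0 y0] := generic_lift gV.
have recW' : linrec k (fun i => x (i + n%:Z)) (fun i => y (i + n%:Z))
    (fun i => W (i + n%:Z)).
  exact: linrec_shift.
have [|||[c c0 cE] xn yn] := lift_uniq (linrec_map M recW) recW'.
- by move=> i; apply: indep3_inj.
- move=> i; suff [] : [/\ W (i + n%:Z) != 0, W (i + n%:Z + 1) != 0 &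
    W (i + n%:Z + k%:Z - 1) != 0] by [].
  exact: indep3_neq0 (ind _).
- by move=> i; rewrite -limg_line -!VE MV.
split=> //.
have NE v : v *m (c *: lin1_mx M) = c *: M v.
  by rewrite -scalemxAr mul_rV_lin1.
exists (c *: lin1_mx M) => [|i]; last by rewrite NE cE.
rewrite -row_free_unit; apply: inj_row_free => v; rewrite NE => /eqP.
by rewrite scaler_eq0 (negPf c0) /= => /eqP; rewrite -[RHS](linear0 M) => /Minj.
Qed.

End Lift.

Lemma linfun_mulmxr_inj (F : fieldType) d (N : 'M[F]_d) : N \in unitmx ->
  lker (linfun (mulmxr N : 'rV_d -> 'rV_d)) == 0%VS.
Proof.
move=> Nu; apply/lker0P => u v; rewrite !lfunE /= => /(congr1 (mulmx^~ (invmx N))).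
by rewrite !mulmxK.
Qed.

Lemma twisted_line (R : realType) d n (W : int -> 'rV[R[i]]_d) N :
  N \in unitmx -> (forall i, W i != 0) -> (forall i, W (i + n%:Z) = W i *m N) ->
  twisted n (fun i => <[W i]>%VS).
Proof.
move=> Nu W0 WN; split=> [i|]; first by rewrite dim_vline W0.
exists (linfun (mulmxr N : 'rV_d -> 'rV_d)); first exact: linfun_mulmxr_inj.
by move=> i; rewrite limg_line lfunE /= WN.
Qed.

Lemma proj_equiv_line (R : realType) d (W : int -> 'rV[R[i]]_d) N :
  N \in unitmx ->
  proj_equiv (fun i => <[W i]>%VS) (fun i => <[W i *m N]>%VS).
Proof.
move=> Nu; exists (linfun (mulmxr N : 'rV_d -> 'rV_d)).
  exact: linfun_mulmxr_inj.
by move=> i; rewrite limg_line lfunE.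
Qed.

Lemma proj_equiv_refl (R : realType) d (V : gon R d) : proj_equiv V V.
Proof.
exists \1%VF => [|i]; last by rewrite lim1g.
by apply/lker0P => u v; rewrite !id_lfunE.
Qed.

Lemma proj_equiv_sym (R : realType) d (V V' : gon R d) :
  proj_equiv V V' -> proj_equiv V' V.
Proof.
move=> [A A0 AV]; exists (A^-1)%VF => [|i].
  apply/lker0P => u v e; rewrite -[u](lker0_lfunVK A0) -[v](lker0_lfunVK A0).
  by rewrite e.
by rewrite AV -limg_comp lker0_compVf // lim1g.
Qed.

Lemma proj_equiv_trans (R : realType) d (V V' V'' : gon R d) :
  proj_equiv V V' -> proj_equiv V' V'' -> proj_equiv V V''.
Proof.
move=> [A A0 AV] [B B0 BV]; exists (B \o A)%VF => [|i].
  apply/lker0P => u v; rewrite !comp_lfunE.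
  by move/(lker0P B0)/(lker0P A0).
by rewrite BV AV limg_comp.
Qed.

Lemma proj_class_eq (R : realType) d (V V' : gon R d) :
  proj_class V = proj_class V' <-> proj_equiv V V'.
Proof.
split=> [e|VV'].
  have : proj_class V V' by rewrite e; apply: proj_equiv_refl.
  by [].
apply/seteqP; split=> U UV; first exact: proj_equiv_trans (proj_equiv_sym VV') UV.
exact: proj_equiv_trans VV' UV.
Qed.

(** * Coordinates of a polygon and of its pentagram image *)

Section Coordinates.

Variables (R : realType) (d k n : nat) (hn : (0 < n)%N).
Implicit Types (V : gon R d) (xy : xy_space R n).

Lemma has_coordsE V xy : has_coords k V xy <-> exists2 W : int -> 'rV[R[i]]_d,
  (forall i, V i = <[W i]>%VS) & linrec k (periodic xy.1) (periodic xy.2) W.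
Proof. by split=> [[W []]|[W]]; exists W. Qed.

Lemma coords_uniq V xy xy' : generic_gon k V ->
  has_coords k V xy -> has_coords k V xy' -> xy = xy'.
Proof.
move=> gV /has_coordsE[W VW recW] /has_coordsE[W' VW' recW'].
have [ind _ _] := generic_lift VW recW gV.
have [ind' _ _] := generic_lift VW' recW' gV.
have [|i|_ ex ey] := lift_uniq recW recW' ind.
- by move=> i; have [] := indep3_neq0 (ind' i).
- by rewrite -VW -VW'.
rewrite (surjective_pairing xy) (surjective_pairing xy').
by rewrite (periodic_inj hn ex) (periodic_inj hn ey).
Qed.

Lemma psi_eq V xy : generic_gon k V -> has_coords k V xy -> psi k n V = xy.
Proof.
move=> gV Vxy; apply: xget_unique => // xy' Vxy'.
exact: coords_uniq gV Vxy' Vxy.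
Qed.

(** A value other than the default of [xget] can only come from actual coordinates. *)
Lemma psi_has_coords V : psi k n V != (0, 0) -> has_coords k V (psi k n V).
Proof. by rewrite /psi; case: xgetP => //; rewrite eqxx. Qed.

Definition pent_xy xy : xy_space R n :=
  (\row_(j < n) pent_x k (periodic xy.1) (periodic xy.2) (j : nat)%:Z,
   \row_(j < n) pent_y k (periodic xy.1) (periodic xy.2) (j : nat)%:Z).

Lemma periodic_pent_xy xy :
  periodic (pent_xy xy).1 = pent_x k (periodic xy.1) (periodic xy.2) /\
  periodic (pent_xy xy).2 = pent_y k (periodic xy.1) (periodic xy.2).
Proof.
split; apply/funext; apply: periodic_row => // i.
  rewrite /pent_x.
  have -> : i + n%:Z + k%:Z - 1 = i + k%:Z - 1 + n%:Z by lia.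
  by rewrite !periodicD.
rewrite /pent_y.
have -> : i + n%:Z + k%:Z = i + k%:Z + n%:Z by lia.
have -> : i + n%:Z + 1 = i + 1 + n%:Z by lia.
by rewrite !periodicD.
Qed.

Lemma pentagramE V W x y : (forall i, V i = <[W i]>%VS) -> linrec k x y W ->
  generic_gon k V -> forall i, pentagram k V i = <[pent_lift k y W i]>%VS.
Proof.
move=> VW recW gV i; have [ind _ _] := generic_lift VW recW gV.
by rewrite /pentagram !VW (pent_line recW).
Qed.

(* If x_i + y_i = 0 then two consecutive vertices of the image coincide. *)
Lemma pent_sum_neq0 V W x y : (forall i, V i = <[W i]>%VS) -> linrec k x y W ->
  generic_gon k V -> generic_gon k (pentagram k V) ->
  forall i, x i + y i != 0.
Proof.
move=> VW recW gV gpV i; apply/eqP => s0.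
have := gpV (i + 1 - k%:Z); rewrite /no_three_collinear.
rewrite !(pentagramE VW recW gV) => /and4P[_ _ /collinearPn + _].
have := pent_lift_diff recW (i + 1 - k%:Z); rewrite !subrK.
rewrite addrK s0 scale0r add0r => -> /(_ 0 1 (- 1)).
by rewrite scale0r add0r scaleN1r scale1r subrr => -[//|_ /eqP]; rewrite oner_eq0.
Qed.

Lemma pent_has_coords V xy : has_coords k V xy ->
  generic_gon k V -> (forall i, periodic xy.1 i + periodic xy.2 i != 0) ->
  has_coords k (pentagram k V) (pent_xy xy).
Proof.
move=> /has_coordsE[W VW recW] gV s0; apply/has_coordsE.
have [ex ey] := periodic_pent_xy xy; rewrite ex ey.
exists (pent_lift k (periodic xy.2) W); first exact: pentagramE VW recW gV.
exact: linrec_pent recW s0.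
Qed.

End Coordinates.

(* Any lift is rescaled by factors t_i with t_(i+k) c_i = t_(i+k-1), where c_i is
   the coefficient of its term i + k - 1. *)
Lemma plane_has_coords (R : realType) (k n : nat) (V : gon R 3) :
  (0 < n)%N -> plane_gon k n V -> exists xy : xy_space R n, has_coords k V xy.
Proof.
move=> hn [tV gV].
have /choice[W0 W0P] i : exists w, V i = <[w]>%VS.
  have dV : \dim (V i) = 1%N := tV.1 i.
  exists (vpick (V i)); apply/esym/eqP; rewrite eqEdim.
  rewrite -memvE memv_pick /= dV dim_vline vpick0 -dimv_eq0 dV.
  by [].
have /choice[c cP] i : exists c : R[i] * R[i] * R[i], c.2 != 0 /\
    W0 (i + k%:Z) = c.1.1 *: W0 i + c.1.2 *: W0 (i + 1) + c.2 *: W0 (i + k%:Z - 1).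
  have := gV i; rewrite /no_three_collinear !W0P.
  move=> /and4P[/collinearPn h1 /collinearPn h2 _ _].
  have /row_freeP[B BE] := (row_free_rows3P _ _ _).2 h1.
  have : W0 (i + k%:Z) = W0 (i + k%:Z) *m B *m
      rows3 (W0 i) (W0 (i + 1)) (W0 (i + k%:Z - 1)).
    by rewrite -mulmxA (mulmx1C BE) mulmx1.
  rewrite mulmx_sum_row !big_ord_recl big_ord0 addr0 !rowK addrA /=.
  set p := fun_of_matrix _ 0 _; set q := fun_of_matrix _ 0 _; set r := fun_of_matrix _ 0 _.
  move=> e; exists (p, q, r); split=> //=.
  (* If [r] were 0, the vertices [i], [i + 1] and [i + k] would be collinear. *)
  apply/eqP => r0; have [] := h2 p q (- 1).
    by rewrite e r0 scale0r addr0 scaleN1r subrr.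
  by move=> _ _ /eqP; rewrite oppr_eq0 oner_eq0.
(* The index is shifted so that dividing by [u i] carries the factor at [i] to the factor at
   [i + 1]. *)
pose u i := (c (i + 1 - k%:Z)).2.
have u0 i : u i != 0 by have [] := cP (i + 1 - k%:Z).
have uK i : cancel (fun t => u i * t) (fun t => t / u i).
  by move=> t; rewrite mulrC mulKf.
have [t t0 tS] := @int_rec _ _ _ 1 uK.
have tn0 : forall i, t i != 0.
  apply: int_ind2 => [|i IH|i]; first by rewrite t0 oner_neq0.
    by rewrite tS mulf_neq0 // invr_neq0.
  by rewrite tS mulf_eq0 negb_or => /andP[].
pose x i := t (i + k%:Z) * (c i).1.2 / t (i + 1).
pose y i := t (i + 1 + k%:Z) * (c (i + 1)).1.1 / t (i + 1).
pose W i := t i *: W0 i.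
have VW i : V i = <[W i]>%VS.
  rewrite W0P /W; apply/eqP; rewrite eqEdim !dim_vline scaler_eq0 (negPf (tn0 i)).
  rewrite leqnn andbT -memvE; apply/vlineP; exists (t i)^-1.
  by rewrite scalerA mulVf // scale1r.
have recW : linrec k x y W.
  move=> i; rewrite /W /x /y !subrK (cP i).2 !scalerDr !scalerA !divfK //.
  congr (_ + _ *: _).
  have := tS (i + k%:Z - 1); rewrite subrK => ->.
  by rewrite /u !subrK addrK divfK // (cP i).1.
(* The factors [t] were chosen without regard to the period; periodicity of the coefficients follows
   afterwards from twistedness. *)
have [_ xn yn] := twisted_lift VW recW tV gV.
exists (\row_(j < n) x (j : nat)%:Z, \row_(j < n) y (j : nat)%:Z).
apply/has_coordsE; exists W => //=.
rewrite (_ : periodic _ = x); last exact/funext/periodic_row.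
by rewrite (_ : periodic _ = y); last exact/funext/periodic_row.
Qed.

(** * Fundamental solutions and corrugated polygons *)

Definition window (A : Type) k d (W : int -> 'rV[A]_d) (i : int) : 'M[A]_(k, d) :=
  \matrix_(a < k) W (i + (a : nat)%:Z).

(** Dual form of the statement that the vectors [W i] span the space: no nonzero linear form
    vanishes on all of them. *)
Definition separating (F : fieldType) d (W : int -> 'rV[F]_d) :=
  forall c : 'cV[F]_d, (forall i, W i *m c = 0) -> c = 0.

Section Fundamental.

Variables (F : fieldType) (k : nat) (x y : int -> F).
Hypotheses (hk : (2 < k)%N) (y_neq0 : forall i, y i != 0).

(** A linear form vanishing on [k] consecutive values of [W] gives a scalar solution with zero
    initial data, hence vanishes on every [W i]. *)
Lemma window_unit (W : int -> 'rV[F]_k) (i : int) :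
  linrec k x y W -> separating W -> window k W i \in unitmx.
Proof.
move=> recW sepW; rewrite -unitmx_tr -row_free_unit.
apply: inj_row_free => v vS; apply: trmx_inj; rewrite trmx0; apply: sepW => j.
have recWi : linrec k (fun j => x (j + i)) (fun j => y (j + i))
    (fun j => W (j + i) *m v^T).
  exact: (linrec_map (mulmxr v^T) (linrec_shift i recW)).
have rec0 : linrec k (fun j => x (j + i)) (fun j => y (j + i))
    (fun j => 0 : 'M[F]_1).
  by move=> ?; rewrite !scaler0 !addr0.
have := linrec_uniq hk (fun j => y_neq0 (j + i)) recWi rec0.
move=> /(_ _ (j - i)); rewrite subrK; apply=> a ak.
have /(congr1 (fun M => M^T)) := vS; rewrite trmx_mul trmxK => /row_matrixP.
move=> /(_ (Ordinal ak)); rewrite row_mul rowK /= addrC => ->.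
by rewrite trmx0 row0.
Qed.

Lemma unitmx_rows3 (M : 'M[F]_k) (a b c : 'I_k) : M \in unitmx ->
  a != b -> a != c -> b != c -> indep3 (row a M) (row b M) (row c M).
Proof.
move=> Mu ab ac bc al be ga; rewrite !rowE !scalemxAl -!mulmxDl.
move=> /(congr1 (mulmx^~ (invmx M))); rewrite mulmxK // mul0mx => /rowP e.
split.
- by have := e a; rewrite !mxE !eqxx /= (negPf ab) (negPf ac) mulr1 !mulr0 !addr0.
- have := e b; rewrite !mxE !eqxx /= (negPf bc) [b == a]eq_sym (negPf ab).
  by rewrite mulr1 !mulr0 addr0 add0r.
- have := e c; rewrite !mxE !eqxx /= [c == a]eq_sym [c == b]eq_sym.
  by rewrite (negPf bc) (negPf ac) mulr1 !mulr0 !add0r.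
Qed.

Lemma separating_indep3 (W : int -> 'rV[F]_k) (i : int) :
  linrec k x y W -> separating W ->
  indep3 (W i) (W (i + 1)) (W (i + k%:Z - 1)).
Proof.
move=> recW sepW; have Wu := window_unit i recW sepW.
have h0 : (0 < k)%N by lia.
have h1 : (1 < k)%N by lia.
have h2 : (k.-1 < k)%N by lia.
have := unitmx_rows3 (a := Ordinal h0) (b := Ordinal h1) (c := Ordinal h2) Wu.
rewrite !rowK [nat_of_ord _]/= [nat_of_ord (Ordinal h1)]/= [nat_of_ord (Ordinal h2)]/= addr0.
have -> : i + k.-1%:Z = i + k%:Z - 1 by lia.
by apply; rewrite -val_eqE /=; lia.
Qed.

Lemma fundamental_exists : exists2 u : int -> 'rV[F]_k,
  linrec k x y u & forall j : 'I_k, u (j : nat)%:Z = delta_mx 0 j.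
Proof.
have [u recu uE] :=
  linrec_exists x hk y_neq0 (fun j => \row_(a < k) (a == j :> nat)%:R : 'rV[F]_k).
exists u => // j; rewrite uE //; apply/rowP => a.
by rewrite !mxE eqxx /=.
Qed.

Variable u : int -> 'rV[F]_k.
Hypotheses (recu : linrec k x y u)
  (uE : forall j : 'I_k, u (j : nat)%:Z = delta_mx 0 j).

Lemma fundamental_window : window k u 0 = 1%:M.
Proof.
by apply/row_matrixP => a; rewrite rowK add0r uE rowE mulmx1.
Qed.

Lemma fundamental_separating : separating u.
Proof.
move=> c cu; rewrite -[c]mul1mx -fundamental_window.
apply/row_matrixP => a; rewrite row_mul rowK cu.
by rewrite row0.
Qed.

Lemma fundamental_sol d (W : int -> 'rV[F]_d) :
  linrec k x y W -> forall i, W i = u i *m window k W 0.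
Proof.
move=> recW; apply: (linrec_uniq hk y_neq0 recW).
  exact: (linrec_map (mulmxr (window k W 0)) recu).
move=> j jk; rewrite (uE (Ordinal jk)) -rowE rowK.
by rewrite add0r.
Qed.

Variable n : nat.
Hypotheses (xn : forall i, x (i + n%:Z) = x i) (yn : forall i, y (i + n%:Z) = y i).

(** Since the coefficients are periodic, the shift of [u] by [n] is again a solution, determined by
    its initial window. That window is the monodromy matrix. *)
Lemma fundamental_shift i : u (i + n%:Z) = u i *m window k u n%:Z.
Proof.
have recs : linrec k x y (fun i => u (i + n%:Z)).
  have := linrec_shift n%:Z recu.
  by rewrite (funext xn) (funext yn).
rewrite (fundamental_sol recs i); congr (_ *m _).
apply/row_matrixP => a; rewrite !rowK.
by rewrite add0r addrC.
Qed.

Lemma monodromy_unit : window k u n%:Z \in unitmx.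
Proof. exact: window_unit recu fundamental_separating. Qed.

End Fundamental.

Lemma pent_separating (F : fieldType) d (k : nat) (x y : int -> F)
    (W : int -> 'rV[F]_d) : linrec k x y W -> (forall i, x i + y i != 0) ->
  separating W -> separating (pent_lift k y W).
Proof.
move=> recW s0 sepW c cU; apply: sepW => i.
have := congr1 (mulmx^~ c) (pent_lift_combE recW (i - k%:Z)).
rewrite subrK mulmxDl -!scalemxAl !cU !scaler0 addr0 => /esym/eqP.
by rewrite scaler_eq0 (negPf (s0 _)) /= => /eqP.
Qed.

Lemma pent_lift_shift (F : fieldType) d (k n : nat) (y : int -> F)
    (W : int -> 'rV[F]_d) N :
  (forall i, y (i + n%:Z) = y i) -> (forall i, W (i + n%:Z) = W i *m N) ->
  forall i, pent_lift k y W (i + n%:Z) = pent_lift k y W i *m N.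
Proof.
move=> yn WN i; rewrite /pent_lift.
have -> : i + n%:Z + k%:Z - 1 = i + k%:Z - 1 + n%:Z by lia.
have -> : i + n%:Z - 1 = i - 1 + n%:Z by lia.
by rewrite yn !WN scalemxAl -mulmxDl.
Qed.

Lemma corrugated_line (R : realType) (k n : nat) (x y : int -> R[i])
    (W : int -> 'rV[R[i]]_k) N : (2 < k)%N ->
  linrec k x y W -> (forall i, x i != 0) -> (forall i, y i != 0) ->
  separating W -> N \in unitmx -> (forall i, W (i + n%:Z) = W i *m N) ->
  corrugated_gon n (fun i => <[W i]>%VS).
Proof.
move=> hk recW x0 y0 sepW Nu WN.
have ind i : indep3 (W i) (W (i + 1)) (W (i + k%:Z - 1)).
  exact: (@separating_indep3 _ _ x y hk y0 W i recW sepW).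
split; last exact: (lift_generic (fun=> erefl) recW ind x0 y0).
split=> [|i|i].
- by apply: twisted_line Nu _ WN => i; have [] := indep3_neq0 (ind i).
- have Wu := window_unit hk y0 i recW sepW.
  apply/vspaceP => v; rewrite memvf.
  rewrite -[v](mulmxKV Wu) mulmx_sum_row; apply: rpred_sum => a _.
  rewrite rowK memvZ //.
  by apply: (subvP (sumv_sup a _ (subvv _))) => //; apply: memv_line.
(* By the recurrence the fourth vertex lies in the plane of the other three. *)
- rewrite (addv_idPl _).
    have /free3P := ind i; rewrite /free.
    by rewrite !span_cons span_nil addv0 addvA => /eqP.
  rewrite -memvE recW !memv_add ?memvZ ?memv_line //.
Qed.

(** [corr_map] is defined through corrugated polygons with the given coordinates. The fundamental
    solution supplies one, and its image and that of [V] both have coordinates [pent_xy xy]. *)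
Lemma psi_pentagram (R : realType) (k n : nat) (V : gon R 3) :
  (2 < k)%N -> (0 < n)%N -> plane_gon k n V -> plane_gon k n (pentagram k V) ->
  psi k n (pentagram k V) = corr_map k (psi k n V).
Proof.
move=> hk hn pV ppV; have [xy Vxy] := plane_has_coords hn pV.
have [_ gV] := pV; have [_ gpV] := ppV.
rewrite (psi_eq hn gV Vxy).
have /has_coordsE[W VW recW] := Vxy.
have s0 := pent_sum_neq0 VW recW gV gpV.
have [_ x0 y0] := generic_lift VW recW gV.
rewrite (psi_eq hn gpV (pent_has_coords hn Vxy gV s0)); apply/esym.
have xn := periodicD hn xy.1; have yn := periodicD hn xy.2.
have [u recu uE] := fundamental_exists (periodic xy.1) hk y0.
have us := fundamental_shift hk y0 recu uE xn yn.
have Tu := monodromy_unit hk y0 recu uE n.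
have sepu := fundamental_separating uE.
have cu := corrugated_line hk recu x0 y0 sepu Tu us.
have gu := cu.2.
set Vu : gon R k := fun i => _ in cu gu.
have Vuxy : has_coords k Vu xy by apply/has_coordsE; exists u.
apply: xget_unique.
  exists Vu; split=> //; last exact: pent_has_coords.
  rewrite (funext (pentagramE (fun=> erefl) recu gu)).
  apply: (corrugated_line hk (linrec_pent recu s0) _ _ _ Tu).
  - by move=> i; rewrite /pent_x !mulf_neq0 ?invr_neq0.
  - by move=> i; rewrite /pent_y !mulf_neq0 ?invr_neq0.
  - exact: pent_separating recu s0 sepu.
  - exact: pent_lift_shift yn us.
(* Any other corrugated polygon with coordinates [xy] yields the same image coordinates, so the
   value of [corr_map] is forced. *)
move=> xy' [V' [[_ gV'] V'xy [_ gpV'] pV'xy']].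
apply: (coords_uniq hn gpV' pV'xy').
exact: pent_has_coords V'xy gV' s0.
Qed.

(** * The fibres of psi *)

Section Subsets.

Variable k : nat.
Implicit Type A : {set 'I_k.+1}.

Definition triple A (j : 'I_3) : 'I_k.+1 := nth ord0 (enum A) j.

Lemma triple_inj A : #|A| = 3%N -> injective (triple A).
Proof.
move=> A3 i j /eqP; rewrite nth_uniq ?enum_uniq -?cardE ?A3 // => /eqP.
exact: val_inj.
Qed.

Lemma triple_imset A : #|A| = 3%N -> triple A @: [set: 'I_3]%SET = A.
Proof.
move=> A3; apply/setP => a; apply/imsetP/idP => [[j _ ->]|aA].
  by rewrite -mem_enum mem_nth // -cardE A3.
have aj : (index a (enum A) < 3)%N by rewrite -A3 cardE index_mem mem_enum.
by exists (Ordinal aj); rewrite ?inE // /triple /= nth_index // mem_enum.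
Qed.

End Subsets.

Section Decomposition.

Variables (F : fieldType) (k : nat) (Q T : 'M[F]_k.+1) (lam : 'I_k.+1 -> F).
Hypotheses (Qu : Q \in unitmx) (lam_inj : injective lam).
Hypothesis TQ : T *m Q = Q *m diag_mx (\row_a lam a).

Lemma mulmx_colsub_rowsub m (Z : 'M[F]_(k.+1, m)) (g : 'I_3 -> 'I_k.+1) :
  injective g -> (forall a, a \notin g @: [set: 'I_3]%SET -> row a Z = 0) ->
  Q *m Z = colsub g Q *m rowsub g Z.
Proof.
move=> gI Z0; apply/matrixP => i j; rewrite !mxE.
rewrite (bigID (fun a => a \in g @: [set: 'I_3]%SET)) /= [X in _ + X]big1 => [|a /Z0/rowP/(_ j)].
  rewrite addr0 big_imset /=; last by move=> ? ? _ _ /gI.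
  by apply: eq_big => [l|l _]; rewrite ?inE // !mxE.
by rewrite !mxE => ->; rewrite mulr0.
Qed.

(* In an eigenbasis of [T] the rows of B are left eigenvectors of N for distinct
   eigenvalues, or zero; as B has rank 3, exactly three of them are nonzero. *)
Lemma invariant_decomp (B : 'M[F]_(k.+1, 3)) (N : 'M[F]_3) :
  row_full B -> T *m B = B *m N ->
  exists A : {set 'I_k.+1}, #|A| = 3%N /\ exists2 G, G \in unitmx & B = colsub (triple A) Q *m G.
Proof.
move=> Bfull TB; pose Z := invmx Q *m B.
have BE : B = Q *m Z by rewrite mulKVmx.
have ZN : diag_mx (\row_a lam a) *m Z = Z *m N.
  by rewrite -[LHS](mulKmx Qu) [Q *m _]mulmxA -TQ -(mulmxA T) -BE TB -mulmxA.
have [B' B'B] := row_fullP Bfull.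
have Zfull : row_full Z by apply/row_fullP; exists (B' *m Q); rewrite -mulmxA -BE.
pose f := fullrankfun Zfull; have fI : injective f by exact: fullrankfun_inj.
have Zfu : rowsub f Z \in unitmx := fullrowsub_unit Zfull.
have lamZ a : row a Z *m N = lam a *: row a Z.
  by rewrite -row_mul -ZN row_mul row_diag_mx -scalemxAl -rowE mxE.
have ZfN : rowsub f Z *m N = diag_mx (\row_j lam (f j)) *m rowsub f Z.
  apply/row_matrixP => j; rewrite !row_mul row_diag_mx -scalemxAl -rowE mxE.
  by rewrite row_rowsub lamZ.
have Z0 a : a \notin f @: [set: 'I_3]%SET -> row a Z = 0.
  move=> af; pose w := row a Z *m invmx (rowsub f Z).
  have wE : row a Z = w *m rowsub f Z by rewrite mulmxKV.
  suff w0 : w = 0 by rewrite wE w0 mul0mx.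
  have : w *m diag_mx (\row_j lam (f j)) = lam a *: w.
    apply: (can_inj (mulmxK Zfu)).
    by rewrite -mulmxA -ZfN mulmxA -scalemxAl -wE lamZ.
  move=> /rowP e; apply/rowP => j; have := e j.
  rewrite mul_mx_diag !mxE mulrC => /eqP; rewrite -subr_eq0 -mulrBl mulf_eq0.
  case/orP => [|/eqP //]; rewrite subr_eq0 => /eqP/lam_inj fja.
  by case/negP: af; apply/imsetP; exists j; rewrite ?inE.
pose A := f @: [set: 'I_3]%SET.
have A3 : #|A| = 3%N by rewrite card_imset // cardsT card_ord.
exists A; split=> //.
(* [f] and [triple A] list the same set, possibly in different orders, so the factorization is
   redone along [triple A]. *)
have BE' : B = colsub (triple A) Q *m rowsub (triple A) Z.
  rewrite BE; apply: mulmx_colsub_rowsub (triple_inj A3) _ => a.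
  by rewrite triple_imset //; apply: Z0.
exists (rowsub (triple A) Z) => //.
by move: B'B; rewrite BE' mulmxA => /mulmx1_unit[].
Qed.

(** After multiplication by the inverse of [Q] the columns become coordinate vectors. For [a] in [A]
    but not in [A'], row [a] would contain a 1 on the left and vanish on the right. *)
Lemma colsub_triple_inj (A A' : {set 'I_k.+1}) (G : 'M[F]_3) :
  #|A| = 3%N -> #|A'| = 3%N -> colsub (triple A) Q = colsub (triple A') Q *m G ->
  A = A'.
Proof.
move=> A3 A'3 e; apply/eqP; rewrite eqEcard A3 A'3 leqnn andbT.
apply/fintype.subsetP => a; rewrite -{1}(triple_imset A3) => /imsetP[j _ aE].
have QK f : invmx Q *m colsub f Q = colsub f 1%:M :> 'M_(_, 3).
  by rewrite mulmx_colsub mulVmx.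
move: e => /(congr1 (mulmx (invmx Q))); rewrite mulmxA !QK => /matrixP/(_ a j).
rewrite !mxE -aE eqxx; apply: contra_eqT => aA'.
rewrite big1 ?oner_neq0 // => l _; rewrite !mxE.
have [alE|_] := eqVneq; last by rewrite mul0r.
by case/negP: aA'; rewrite alE -mem_enum mem_nth // -cardE A'3.
Qed.

End Decomposition.

Lemma int_periodic_ind (n : nat) (P : int -> Prop) : (0 < n)%N ->
  (forall i, P (i + n%:Z) <-> P i) ->
  (forall j : nat, (j < n)%N -> P j%:Z) -> forall i, P i.
Proof.
move=> hn Pn P0 i.
have Pn' j : P (j + n%:Z) = P j by apply/propext.
rewrite (divz_eq i n%:Z) addrC (shiftM_eq Pn').
have -> : (i %% n%:Z)%Z = (residue hn i : nat)%:Z.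
  by rewrite /= gez0_abs // modz_ge0 //; lia.
exact/P0.
Qed.

Lemma indep3_mulmx (F : fieldType) (N : 'M[F]_3) (a b c : 'rV_3) : N \in unitmx ->
  indep3 (a *m N) (b *m N) (c *m N) <-> indep3 a b c.
Proof.
rewrite unitmxE unitfE => N0.
by rewrite -!det_rows3P -rows3M det_mulmx mulf_eq0 negb_or N0 andbT.
Qed.

(** The monodromy reduces independence at all indices to [n] of them, so that finitely many
    determinants suffice. *)
Lemma indep3_periodic (F : fieldType) n (W : int -> 'rV[F]_3) (N : 'M[F]_3) p q :
  (0 < n)%N -> N \in unitmx -> (forall i, W (i + n%:Z) = W i *m N) ->
  (forall j : nat, (j < n)%N -> indep3 (W j%:Z) (W (j%:Z + p)) (W (j%:Z + q))) ->
  forall i, indep3 (W i) (W (i + p)) (W (i + q)).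
Proof.
move=> hn Nu WN W0; apply: (int_periodic_ind hn _ W0) => i.
by rewrite (addrAC i n%:Z p) (addrAC i n%:Z q) !WN indep3_mulmx.
Qed.

(** * The fibre over a point whose monodromy has distinct eigenvalues *)

Section Fiber.

Variables (R : realType) (k n : nat) (xy : xy_space R n).
Notation K := k.+1.
Notation x := (periodic xy.1).
Notation y := (periodic xy.2).
Variables (u : int -> 'rV[R[i]]_K) (Q : 'M[R[i]]_K) (lam : 'I_K -> R[i]).
Hypotheses (hK : (2 < K)%N) (hn : (0 < n)%N).
Hypotheses (x0 : forall i, x i != 0) (y0 : forall i, y i != 0).
Hypotheses (recu : linrec K x y u)
  (uE : forall j : 'I_K, u (j : nat)%:Z = delta_mx 0 j).
Hypotheses (Qu : Q \in unitmx) (lam_inj : injective lam)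
  (TQ : window K u n%:Z *m Q = Q *m diag_mx (\row_a lam a)).
Hypothesis indQ : forall g : 'I_3 -> 'I_K, injective g ->
  forall i : nat, (i < n)%N ->
  \det (rows3 (u i%:Z) (u (i%:Z + 1)) (u (i%:Z + (K%:Z - 1))) *m colsub g Q) != 0.

Let xn := periodicD hn xy.1.
Let yn := periodicD hn xy.2.
Let uS := fundamental_shift hK y0 recu uE xn yn.
Let Tu := monodromy_unit hK y0 recu uE n.

Lemma xy_neq0 : xy != (0, 0).
Proof.
apply/eqP => z; have := x0 0; rewrite z periodicE //= mxE eqxx //.
Qed.

Lemma lam_neq0 a : lam a != 0.
Proof.
apply/eqP => l0.
have : window K u n%:Z *m Q *m delta_mx a 0 == 0 :> 'cV_K.
  rewrite TQ -mulmxA; apply/eqP; rewrite -[RHS](mulmx0 _ Q); congr (_ *m _).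
  apply/colP => b; rewrite mul_diag_mx !mxE eqxx andbT.
  by have [->|] := eqVneq b a; rewrite ?l0 ?mul0r ?mulr0.
have TQu : window K u n%:Z *m Q \in unitmx by rewrite unitmx_mul Tu.
move/eqP/(congr1 (mulmx (invmx (window K u n%:Z *m Q)))).
rewrite mulKmx // mulmx0 => /colP/(_ a); rewrite !mxE !eqxx => /eqP.
by rewrite oner_eq0.
Qed.

(** The representatives of the fibre, one for each choice of three eigenvectors. *)
Definition eigengon (A : {set 'I_K}) : gon R 3 :=
  fun i => <[u i *m colsub (triple A) Q]>%VS.

Definition eigen_monodromy (g : 'I_3 -> 'I_K) : 'M[R[i]]_3 :=
  diag_mx (\row_j lam (g j)).

Lemma eigen_monodromy_unit (g : 'I_3 -> 'I_K) : eigen_monodromy g \in unitmx.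
Proof.
rewrite unitmxE unitfE det_diag; apply/prodf_neq0 => j _.
by rewrite mxE lam_neq0.
Qed.

Lemma eigen_shift (g : 'I_3 -> 'I_K) i :
  u (i + n%:Z) *m colsub g Q = u i *m colsub g Q *m eigen_monodromy g.
Proof.
rewrite uS -!mulmxA mulmx_colsub TQ; congr (_ *m _).
by apply/matrixP => a j; rewrite mxE !mul_mx_diag !mxE.
Qed.

Lemma eigen_rec (g : 'I_3 -> 'I_K) : linrec K x y (fun i => u i *m colsub g Q).
Proof. exact: (linrec_map (mulmxr (colsub g Q)) recu). Qed.

Lemma eigen_indep3 (g : 'I_3 -> 'I_K) : injective g -> forall i,
  indep3 (u i *m colsub g Q) (u (i + 1) *m colsub g Q)
    (u (i + K%:Z - 1) *m colsub g Q).
Proof.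
move=> gI i; rewrite -(addrA i).
apply: (indep3_periodic hn (eigen_monodromy_unit g) (eigen_shift g)) => j jn.
apply/det_rows3P; rewrite -rows3M.
exact: indQ.
Qed.

Lemma eigengon_plane (A : {set 'I_K}) : #|A| = 3%N -> plane_gon K n (eigengon A).
Proof.
move=> A3; have ind := eigen_indep3 (triple_inj A3).
split; last exact: (lift_generic (fun=> erefl) (eigen_rec (triple A)) ind x0 y0).
apply: twisted_line (eigen_monodromy_unit (triple A)) _ (eigen_shift _) => i.
have [h _ _] := indep3_neq0 (ind i); exact: h.
Qed.

Lemma eigengon_coords A : has_coords K (eigengon A) xy.
Proof.
by apply/has_coordsE; exists (fun i => u i *m colsub (triple A) Q) => //; apply: eigen_rec.
Qed.

Lemma eigengon_psi (A : {set 'I_K}) : #|A| = 3%N -> psi K n (eigengon A) = xy.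
Proof.
move=> A3; have [_ g] := eigengon_plane A3.
exact (psi_eq hn g (eigengon_coords A)).
Qed.

(** The lift is [u i *m B], where [B] has rank 3 since three of the lifts are independent, and
    twistedness gives [T *m B = B *m N]; then [invariant_decomp] applies. *)
Lemma plane_eigen V : plane_gon K n V -> psi K n V = xy ->
  exists A : {set 'I_K}, #|A| = 3%N /\ exists N G : 'M[R[i]]_3,
  [/\ N \in unitmx, G \in unitmx,
      forall i, V i = <[u i *m colsub (triple A) Q *m G]>%VS,
      linrec K x y (fun i => u i *m colsub (triple A) Q *m G)
    & forall i, u (i + n%:Z) *m colsub (triple A) Q *m G =
        u i *m colsub (triple A) Q *m G *m N].
Proof.
move=> [tV gV] Vxy.
have /has_coordsE[W VW recW] : has_coords K V xy.
  by rewrite -Vxy; apply: psi_has_coords; rewrite Vxy xy_neq0.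
have [[N Nu WN] _ _] := twisted_lift VW recW tV gV.
have [ind _ _] := generic_lift VW recW gV.
pose B := window K W 0.
have WB : forall i, W i = u i *m B := fundamental_sol hK y0 recu uE recW.
have Bfull : row_full B.
  have : rows3 (W 0) (W (0 + 1)) (W (0 + K%:Z - 1)) \in unitmx.
    by rewrite -row_free_unit; apply/row_free_rows3P.
  rewrite !WB -rows3M => h; apply/row_fullP.
  exists (invmx (rows3 (u 0) (u (0 + 1)) (u (0 + K%:Z - 1)) *m B) *m
    rows3 (u 0) (u (0 + 1)) (u (0 + K%:Z - 1))).
  by rewrite -mulmxA mulVmx.
have TB : window K u n%:Z *m B = B *m N.
  apply/row_matrixP => a; rewrite !row_mul !rowK -WB add0r.
  by rewrite addrC WN.
have [A [A3 [G Gu BE]]] := invariant_decomp Qu lam_inj TQ Bfull TB.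
exists A; split=> //; exists N, G.
have WE i : u i *m colsub (triple A) Q *m G = W i.
  by rewrite WB BE mulmxA.
split=> // [i|i|i]; rewrite !WE //.
Qed.

Lemma eigengon_equiv V : plane_gon K n V -> psi K n V = xy ->
  exists2 A : {set 'I_K}, #|A| = 3%N & proj_class V = proj_class (eigengon A).
Proof.
move=> pV Vxy; have [A [A3 [N [G [_ Gu VE _ _]]]]] := plane_eigen pV Vxy.
exists A => //; apply/esym/proj_class_eq.
rewrite (funext VE); exact: proj_equiv_line Gu.
Qed.

(** Both lifts satisfy the same recurrence, so a projective equivalence matches them up to a
    constant. On the initial window, where [u] is the identity, this relates the two eigenvector
    matrices. *)
Lemma eigengon_inj (A A' : {set 'I_K}) : #|A| = 3%N -> #|A'| = 3%N ->
  proj_class (eigengon A) = proj_class (eigengon A') -> A = A'.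
Proof.
move=> A3 A'3 /proj_class_eq[M /lker0P Minj ME].
have ind := eigen_indep3 (triple_inj A3).
have ind' := eigen_indep3 (triple_inj A'3).
have [|||[c c0 cE] _ _] :=
  lift_uniq (linrec_map M (eigen_rec (triple A))) (eigen_rec (triple A')).
- by move=> i; apply: indep3_inj.
- move=> i; have [h _ _] := indep3_neq0 (ind' i); exact: h.
- by move=> i; rewrite -limg_line -ME.
apply/esym; apply: (@colsub_triple_inj _ _ _ Qu _ _ (c *: lin1_mx M)) => //.
rewrite -[LHS]mul1mx -[in RHS](mul1mx (colsub _ Q)) -(fundamental_window uE).
apply/row_matrixP => a; rewrite !row_mul rowK add0r cE.
by rewrite -scalemxAr mul_rV_lin1.
Qed.

Lemma psi_fiber_card : (psi_fiber K xy #= `I_('C(K, 3)))%card.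
Proof.
pose S := enum [set A : {set 'I_K} | #|A| == 3%N].
have sS : size S = 'C(K, 3).
  by rewrite -cardE card_draws card_ord.
have S3 i : (i < 'C(K, 3))%N -> #|nth [set: 'I_K]%SET S i| = 3%N.
  move=> i3; have : nth [set: 'I_K]%SET S i \in S by rewrite mem_nth // sS.
  by rewrite mem_enum inE => /eqP.
have -> : psi_fiber K xy =
    ((fun i => proj_class (eigengon (nth [set: 'I_K]%SET S i))) @` `I_('C(K, 3)))%classic.
  apply/seteqP; split=> c /=.
    move=> [V [pV Vxy] <-]; have [A A3 ->] := eigengon_equiv pV Vxy.
    exists (index A S); last by rewrite nth_index // mem_enum inE A3.
    by rewrite /= -sS index_mem mem_enum inE A3.
  move=> [i /= /S3 i3 <-]; exists (eigengon (nth [set: 'I_K]%SET S i)) => //; split.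
    exact: eigengon_plane.
  exact: eigengon_psi.
apply: inj_card_eq => i j; rewrite !inE /= => i3 j3.
move=> /(eigengon_inj (S3 _ i3) (S3 _ j3))/eqP.
by rewrite nth_uniq ?sS ?enum_uniq // => /eqP.
Qed.

Hypothesis indQ' : forall g : 'I_3 -> 'I_K, injective g ->
  forall i : nat, (i < n)%N ->
  \det (rows3 (u i%:Z) (u (i%:Z + (K%:Z - 1)))
    (u (i%:Z + (K%:Z - 1 + (K%:Z - 1)))) *m colsub g Q) != 0.
Hypothesis s0 : forall i, x i + y i != 0.

Lemma plane_pentagram V : plane_gon K n V -> psi K n V = xy ->
  plane_gon K n (pentagram K V).
Proof.
move=> pV Vxy; have [A [A3 [N [G [Nu Gu VE recW WN]]]]] := plane_eigen pV Vxy.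
pose W i := u i *m colsub (triple A) Q *m G.
have ind' i : indep3 (W i) (W (i + (K%:Z - 1)))
    (W (i + (K%:Z - 1 + (K%:Z - 1)))).
  apply: (indep3_periodic hn Nu WN) => j jn.
  apply/(indep3_mulmx _ _ _ Gu)/det_rows3P; rewrite -rows3M.
  exact: indQ' (triple_inj A3) _ jn.
have gV := pV.2.
have pE := pentagramE VE recW gV.
have indU i : indep3 (pent_lift K y W i) (pent_lift K y W (i + 1))
    (pent_lift K y W (i + K%:Z - 1)).
  apply: (indep3_pent recW (s0 i)).
  (* Shifted by one, the indices become [i + 1], [i + K] and [i + 2K - 1], as in [indep3_pent]. *)
  have := ind' (i + 1).
  have -> : i + 1 + (K%:Z - 1) = i + K%:Z by lia.
  by have -> : i + 1 + (K%:Z - 1 + (K%:Z - 1)) = i + K%:Z + K%:Z - 1 by lia.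
split; last first.
  apply: (lift_generic pE (linrec_pent recW s0) indU) => i.
    by rewrite /pent_x !mulf_neq0 ?invr_neq0.
  by rewrite /pent_y !mulf_neq0 ?invr_neq0.
rewrite (funext pE).
apply: twisted_line Nu _ (pent_lift_shift K yn WN) => i.
have [h _ _] := indep3_neq0 (indU i); exact: h.
Qed.

End Fiber.

(** * The genericity polynomial *)

Section ForwardSolution.

Variables (k n : nat).
Notation K := k.+1.

(* The argument [y] is shifted: [y i] is the coefficient y_(i-1) of W_i.  The
   entry [forward_window x y i j] is the solution at i + j, for j <= k. *)
Fixpoint forward_window (A : comNzRingType) (x y : nat -> A) (i j : nat) : 'rV[A]_K :=
  if i is i'.+1 then
    if (j.+1 < K)%N then forward_window x y i' j.+1 else
    y i' *: forward_window x y i' 0 + x i' *: forward_window x y i' 1 + forward_window x y i' k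
  else \row_a ((a == j :> nat)%:R).

Definition forward_sol (A : comNzRingType) (x y : nat -> A) (i : nat) := forward_window x y i 0.

(** Running the recurrence forwards requires no division by [y], so this makes sense over the
    polynomial ring and its entries are polynomials in the coordinates. *)
Definition forward_monodromy (A : comNzRingType) (x y : nat -> A) : 'M[A]_K :=
  \matrix_(a < K) forward_sol x y (n + a).

(* By Cayley-Hamilton this is an eigenvector for [lam a] (possibly zero) when
   [lam] lists the eigenvalues of [T]. *)
Definition eigvec (A : comNzRingType) (T : 'M[A]_K) (lam : 'I_K -> A)
    (e : 'cV[A]_K) (a : 'I_K) : 'cV[A]_K :=
  horner_mx T (\prod_(b | b != a) ('X - (lam b)%:P)) *m e.

Definition eigmx (A : comNzRingType) (T : 'M[A]_K) (lam : 'I_K -> A)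
    (e : 'cV[A]_K) : 'M[A]_K :=
  \matrix_(r, a) eigvec T lam e a r 0.

(* The first determinant is the genericity of the polygon, given x, y <> 0; the
   second one is the genericity of its image under the pentagram map. *)
Definition genericity (A : comNzRingType) (x y : nat -> A) (lam : 'I_K -> A)
    (e : 'cV[A]_K) : A :=
  let Q := eigmx (forward_monodromy x y) lam e in
  \prod_a \prod_(b | b != a) (lam a - lam b) * \det Q *
  \prod_(g : {ffun 'I_3 -> 'I_K} | injectiveb g) \prod_(i < n)
    (\det (rows3 (forward_sol x y i) (forward_sol x y (i + 1))
              (forward_sol x y (i + k)) *m colsub g Q) *
     \det (rows3 (forward_sol x y i) (forward_sol x y (i + k))
              (forward_sol x y (i + (k + k))) *m colsub g Q)).

Section Map.

Variables (A A' : comNzRingType) (f : {rmorphism A -> A'}).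
Variables (x y : nat -> A) (lam : 'I_K -> A) (e : 'cV[A]_K).

Lemma map_forward_sol i :
  map_mx f (forward_sol x y i) = forward_sol (f \o x) (f \o y) i.
Proof.
rewrite /forward_sol.
suff H j : map_mx f (forward_window x y i j) = forward_window (f \o x) (f \o y) i j by exact: H.
elim: i j => [|i IH] j /=.
  by apply/rowP => a; rewrite !mxE rmorph_nat.
by case: ifP => _; rewrite ?map_mxD ?map_mxZ !IH.
Qed.

Lemma map_forward_monodromy :
  map_mx f (forward_monodromy x y) = forward_monodromy (f \o x) (f \o y).
Proof. by apply/row_matrixP => a; rewrite -map_row !rowK map_forward_sol. Qed.

Lemma map_eigmx (T : 'M[A]_K) : map_mx f (eigmx T lam e) =
  eigmx (map_mx f T) (f \o lam) (map_mx f e).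
Proof.
apply/matrixP => r a; rewrite [LHS]mxE [X in f X]mxE [RHS]mxE.
suff -> : eigvec (map_mx f T) (f \o lam) (map_mx f e) a =
  map_mx f (eigvec T lam e a) by rewrite [RHS]mxE.
rewrite /eigvec map_mxM map_horner_mx; congr (horner_mx _ _ *m _).
rewrite rmorph_prod /=; apply: eq_bigr => b _.
by rewrite map_polyXsubC.
Qed.

Lemma map_genericity :
  f (genericity x y lam e) = genericity (f \o x) (f \o y) (f \o lam) (map_mx f e).
Proof.
rewrite /genericity !rmorphM /= -map_forward_monodromy -map_eigmx det_map_mx.
congr (_ * _ * _).
  rewrite rmorph_prod; apply: eq_bigr => a _.
  by rewrite rmorph_prod; apply: eq_bigr => b _; rewrite rmorphB.
rewrite rmorph_prod; apply: eq_bigr => g _.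
rewrite rmorph_prod; apply: eq_bigr => i _.
by rewrite rmorphM -!det_map_mx !map_mxM !map_rows3 !map_forward_sol map_mxsub.
Qed.

End Map.

Lemma forward_solE (F : fieldType) (x y : int -> F) (u : int -> 'rV[F]_K) : (0 < k)%N ->
  linrec K x y u -> (forall j : 'I_K, u (j : nat)%:Z = delta_mx 0 j) ->
  forall i, forward_sol (fun i => x i%:Z) (fun i => y (i%:Z - 1)) i = u i%:Z.
Proof.
move=> k0 recu uE i; rewrite /forward_sol.
suff H : forall j, (j < K)%N ->
    forward_window (fun i => x i%:Z) (fun i => y (i%:Z - 1)) i j = u (i + j)%N%:Z.
  by rewrite H // addn0.
elim: i => [|i IH] j jK /=.
  rewrite add0n (uE (Ordinal jK)); apply/rowP => a.
  by rewrite !mxE.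
have [jk|jk] := ltnP j.+1 K; first by rewrite IH // addnS.
have -> : j = k by lia.
rewrite !IH //.
have -> : (i.+1 + k)%N%:Z = i%:Z + K%:Z by lia.
rewrite recu addn0.
have -> : i%:Z + K%:Z - 1 = (i + k)%N%:Z by lia.
by have -> : i%:Z + 1 = (i + 1)%N%:Z by lia.
Qed.

End ForwardSolution.

Lemma horner_mx_eigen (F : fieldType) k (T : 'M[F]_k.+1) (p : {poly F}) c
    (v : 'cV[F]_k.+1) : T *m v = c *: v -> horner_mx T p *m v = p.[c] *: v.
Proof.
move=> Tv; elim/poly_ind: p => [|p d IH].
  by rewrite rmorph0 mul0mx horner0 scale0r.
rewrite rmorphD rmorphM /= horner_mx_X horner_mx_C mulmxDl -mulmxA Tv.
rewrite -scalemxAr IH scalerA mul_scalar_mx -scalerDl.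
by rewrite hornerMXaddC mulrC.
Qed.

(** Multiplying the product in [eigvec] by the missing factor gives the characteristic polynomial,
    which annihilates [T] by Cayley-Hamilton. *)
Lemma eigmx_eigen (F : fieldType) k (T : 'M[F]_k.+1) (lam : 'I_k.+1 -> F) e :
  char_poly T = \prod_a ('X - (lam a)%:P) ->
  T *m eigmx T lam e = eigmx T lam e *m diag_mx (\row_a lam a).
Proof.
move=> TE; apply/matrixP => r a; rewrite [LHS]mxE mul_mx_diag [RHS]mxE.
rewrite [X in _ * X]mxE [X in X * _]mxE.
have pE : char_poly T = ('X - (lam a)%:P) * \prod_(b | b != a) ('X - (lam b)%:P).
  by rewrite TE (bigD1 a).
have : (T - (lam a)%:M) *m eigvec T lam e a = 0.
  rewrite /eigvec mulmxA.
  have -> : T - (lam a)%:M = horner_mx T ('X - (lam a)%:P).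
    by rewrite rmorphB /= horner_mx_X horner_mx_C.
  rewrite -[_ *m horner_mx _ _]rmorphM /= -pE.
  by rewrite Cayley_Hamilton mul0mx.
rewrite mulmxBl mul_scalar_mx => /eqP; rewrite subr_eq0 => /eqP/matrixP/(_ r 0).
rewrite [X in X = _ -> _]mxE [X in _ = X -> _]mxE mulrC => <-.
by apply: eq_bigr => b _; rewrite mxE.
Qed.

(** * A point where the genericity polynomial does not vanish *)

Lemma char_poly_diag_conj (F : fieldType) m (T V : 'M[F]_m) (lam : 'I_m -> F) :
  V \in unitmx -> T *m V = V *m diag_mx (\row_a lam a) ->
  char_poly T = \prod_a ('X - (lam a)%:P).
Proof.
move=> Vu TV; pose P := map_mx (@polyC F) V.
have Pdet : \det P != 0.
  by rewrite det_map_mx polyC_eq0 -unitfE -unitmxE.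
have -> : \prod_a ('X - (lam a)%:P) = char_poly (diag_mx (\row_a lam a)).
  rewrite char_poly_trig ?diag_mx_is_trig //; apply: eq_bigr => a _.
  by rewrite !mxE eqxx.
apply: (mulIf Pdet); rewrite /char_poly -det_mulmx [RHS]mulrC -det_mulmx.
rewrite /char_poly_mx mulmxBl mulmxBr -!map_mxM TV.
by rewrite scalar_mxC.
Qed.

Lemma quadratic_three_roots (F : fieldType) (z : 'I_3 -> F) a b c :
  injective z -> (forall s, a + b * z s + c * z s ^+ 2 = 0) ->
  [/\ a = 0, b = 0 & c = 0].
Proof.
move=> zI z0; pose p := Poly [:: a; b; c].
have p0 : p = 0.
  apply: (@roots_geq_poly_eq0 _ _ (codom z)).
  - apply/allP => _ /codomP[s ->]; rewrite /root horner_Poly /=.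
    by rewrite mul0r add0r -[X in _ == X](z0 s); apply/eqP; ring.
  - by rewrite codomE map_inj_uniq ?enum_uniq.
  - by rewrite size_codom card_ord (leq_trans (size_Poly _)).
have H i : [:: a; b; c]`_i = 0 by rewrite -coef_Poly -/p p0 coef0.
by split; [apply: (H 0%N)|apply: (H 1%N)|apply: (H 2%N)].
Qed.

Section Witness.

Variables (F : fieldType) (k n : nat) (t : F) (mu : 'I_k.+1 -> F).
Notation K := k.+1.
Hypotheses (hk : (1 < k)%N) (t0 : t != 0).
Hypotheses (muE : forall a, mu a ^+ K = t + mu a ^+ k)
  (mun_inj : injective (fun a => mu a ^+ n)).

Let x : nat -> F := fun=> 0.
Let y : nat -> F := fun=> t.
Let lam a := mu a ^+ n.
Let V : 'M[F]_K := \matrix_(r, a) mu a ^+ r.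
Let T := forward_monodromy k n x y.
Let e : 'cV[F]_K := \col_r \sum_a mu a ^+ r.

Lemma witness_inj : injective mu.
Proof. by move=> a b ab; apply: mun_inj; rewrite ab. Qed.

Lemma witness_neq0 a : mu a != 0.
Proof.
apply: contraNneq t0 => m0; have := muE a.
by rewrite m0 exprS mul0r expr0n; case: (k) hk => // ? _; rewrite addr0 => <-.
Qed.

Lemma witness_eqn a : mu a ^+ k * (mu a - 1) = t.
Proof. by rewrite mulrBr mulr1 -exprSr muE addrK. Qed.

Lemma witness_forward_sol i a : (forward_sol k x y i *m V) 0 a = mu a ^+ i.
Proof.
suff H : forall j, (j < K)%N -> (forward_window k x y i j *m V) 0 a = mu a ^+ (i + j).
  by rewrite /forward_sol H // addn0.
elim: i => [|i IH] j jK /=.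
  rewrite mxE (bigD1 (Ordinal jK)) //= !mxE eqxx mul1r big1 ?addr0 // => b.
  by rewrite -val_eqE /= => /negPf bj; rewrite !mxE bj mul0r.
have [jk|jk] := ltnP j.+1 K; first by rewrite IH // addnS.
have -> : j = k by lia.
rewrite (_ : x i = 0) // scale0r addr0 mulmxDl -scalemxAl.
rewrite mxE [X in X + _]mxE !IH // (_ : y i = t) //.
by rewrite addSnnS addn0 !exprD muE mulrDr (mulrC t).
Qed.

Lemma witness_V_unit : V \in unitmx.
Proof.
have -> : V = Vandermonde K (\row_a mu a).
  by apply/matrixP => r a; rewrite !mxE.
rewrite unitmxE unitfE det_Vandermonde; apply/prodf_neq0 => i _.
apply/prodf_neq0 => j ij; rewrite !mxE subr_eq0.
by apply: contraTneq ij => /witness_inj ->; rewrite ltnn.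
Qed.

Lemma witness_TV : T *m V = V *m diag_mx (\row_a lam a).
Proof.
apply/matrixP => r a; rewrite mul_mx_diag [RHS]mxE ![in RHS]mxE -exprD addnC.
rewrite -(witness_forward_sol (n + r)) !mxE; apply: eq_bigr => b _.
by rewrite !mxE.
Qed.

Lemma witness_char_poly : char_poly T = \prod_a ('X - (lam a)%:P).
Proof. exact: char_poly_diag_conj witness_V_unit witness_TV. Qed.

Let c a := \prod_(b | b != a) (lam a - lam b).

Lemma witness_c_neq0 a : c a != 0.
Proof.
apply/prodf_neq0 => b ba; rewrite subr_eq0.
by apply: contraNneq ba => /mun_inj ->.
Qed.

(** The vector [e] is the sum of the columns of [V], all eigenvectors of [T]. The polynomial in
    [eigvec] kills every column but the one of index [a], which it scales by [c a]. *)
Lemma witness_eigmx : eigmx T lam e = V *m diag_mx (\row_a c a).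
Proof.
have TVa a : T *m col a V = lam a *: col a V.
  rewrite colE mulmxA witness_TV -!mulmxA scalemxAr; congr (_ *m _).
  apply/colP => b; rewrite mul_diag_mx !mxE eqxx andbT.
  by have [->|] := eqVneq b a; rewrite ?mulr0.
have eE : e = \sum_a col a V.
  by apply/colP => r; rewrite summxE !mxE; apply: eq_bigr => a _; rewrite !mxE.
apply/matrixP => r a; rewrite mul_mx_diag [LHS]mxE [RHS]mxE [X in _ * X]mxE.
rewrite /eigvec eE mulmx_sumr; set p := \prod_(b | _) _.
rewrite (bigD1 a) //= big1 => [|b ba].
  rewrite addr0 (horner_mx_eigen _ (TVa a)) !mxE mulrC; congr (_ * _).
  rewrite horner_prod; apply: eq_bigr => b _.
  by rewrite hornerXsubC.
rewrite (horner_mx_eigen _ (TVa b)) /p (bigD1 b) //= hornerM hornerXsubC.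
by rewrite subrr mul0r scale0r.
Qed.

(** Column [s] carries the nonzero factor [mu (g s) ^+ i * c (g s)]. Once it is cancelled, a
    relation between the rows is one between 1, [mu ^+ p] and [mu ^+ q] at three roots. *)
Lemma witness_det g i p q : injective g ->
  (forall w0 w1 w2, (forall s : 'I_3,
     w0 + w1 * mu (g s) ^+ p + w2 * mu (g s) ^+ q = 0) ->
   [/\ w0 = 0, w1 = 0 & w2 = 0]) ->
  \det (rows3 (forward_sol k x y i) (forward_sol k x y (i + p)) (forward_sol k x y (i + q))
    *m colsub g (eigmx T lam e)) != 0.
Proof.
move=> gI H; rewrite rows3M; apply/det_rows3P => al be ga /rowP E.
apply: H => s; have := E s.
have f j : (forward_sol k x y j *m colsub g (eigmx T lam e)) 0 s =
    mu (g s) ^+ j * c (g s).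
  rewrite mulmx_colsub witness_eigmx mulmxA mul_mx_diag mxE [LHS]mxE.
  by rewrite witness_forward_sol mxE.
have combE (a1 a2 a3 : 'rV[F]_3) : (al *: a1 + be *: a2 + ga *: a3) 0 s =
    al * a1 0 s + be * a2 0 s + ga * a3 0 s by rewrite !mxE.
rewrite combE !f [RHS]mxE => E0.
apply: (mulIf (witness_c_neq0 (g s))).
apply: (mulfI (expf_neq0 i (witness_neq0 (g s)))).
by rewrite mul0r mulr0 -[RHS]E0 !exprD; ring.
Qed.

Lemma witness_genericity : genericity n x y lam e != 0.
Proof.
rewrite /genericity -/T !mulf_neq0 //.
- by apply/prodf_neq0 => a _; apply: witness_c_neq0.
- rewrite witness_eigmx det_mulmx mulf_neq0 //.
    by rewrite -unitfE -unitmxE witness_V_unit.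
  rewrite det_diag; apply/prodf_neq0 => a _; rewrite mxE.
  exact: witness_c_neq0.
apply/prodf_neq0 => g /injectiveP gI; apply/prodf_neq0 => i _.
rewrite mulf_neq0 //; apply: witness_det => // w0 w1 w2 W0.
  (* Multiplying the relation by [mu - 1] and replacing [mu ^+ k * (mu - 1)] by [t] gives a
     quadratic in [mu] with three distinct roots. *)
  have [||e1 e2 e3] := @quadratic_three_roots _ (mu \o g)
    (w2 * t - w0) (w0 - w1) w1.
  - exact: inj_comp witness_inj gI.
  - move=> s /=; rewrite -(witness_eqn (g s)) -[RHS](mul0r (mu (g s) - 1)).
    by rewrite -(W0 s); ring.
  have w10 : w1 = 0 := e3.
  move: e2; rewrite w10 subr0 => w00; split=> //.
  move/eqP: e1; rewrite w00 subr0 mulf_eq0 (negPf t0) orbF => /eqP.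
  by [].
(* Here the relation is quadratic in [mu ^+ k], and these powers are distinct since
   [mu ^+ k * (mu - 1) = t] recovers [mu] from its power. *)
apply: (@quadratic_three_roots _ (fun s => mu (g s) ^+ k)) => [s s' ss'|s].
  apply: gI; apply: witness_inj; have := witness_eqn (g s).
  rewrite -(witness_eqn (g s')) ss' => /mulfI.
  rewrite expf_neq0 ?witness_neq0 // => /(_ isT)/(congr1 (+%R^~ 1)).
  by rewrite !subrK.
by rewrite -exprM muln2 -addnn W0.
Qed.

End Witness.

Lemma exists_notin (F : numDomainType) (s : seq F) : exists t, t \notin s.
Proof.
exists (1 + \sum_(z <- s) `|z|); apply/negP => ts.
set t := 1 + _ in ts; have : `|t| <= \sum_(z <- s) `|z|.
  by rewrite (big_rem _ ts) /= lerDl sumr_ge0.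
have t_ge0 : 0 <= t by rewrite addr_ge0 ?sumr_ge0.
by rewrite ger0_norm // /t -subr_ge0 opprD addrCA subrr addr0 oppr_ge0 ler10.
Qed.

Lemma closed_field_split (F : closedFieldType) m (p : {poly F}) :
  p \is monic -> size p = m.+1 ->
  exists mu : 'I_m -> F, p = \prod_a ('X - (mu a)%:P).
Proof.
move=> pm sp; have [r rE] := closed_field_poly_normal p.
move: rE; rewrite (monicP pm) scale1r => rE.
have sr : size r = m by move: sp; rewrite rE size_prod_XsubC => -[].
exists (fun a => r`_a); rewrite rE (big_nth 0) sr big_mkord.
by [].
Qed.

Section Witness.

Variables (F : numClosedFieldType) (k n : nat).
Hypotheses (hk : (1 < k)%N) (hn : (0 < n)%N).

Lemma multiple_root (p : {poly F}) m (mu : 'I_m -> F) a b :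
  p = \prod_c ('X - (mu c)%:P) -> a != b -> mu a = mu b -> p^`().[mu a] = 0.
Proof.
move=> -> ab mab; rewrite (bigD1 a) //= (bigD1 b) 1?eq_sym //=.
rewrite !(hornerXsubC, derivM, derivXsubC, hornerM, hornerD) mab subrr.
by rewrite !(mul0r, mulr0, addr0).
Qed.

Lemma exists_witness : exists (t : F) (mu : 'I_k.+1 -> F),
  [/\ t != 0, forall a, mu a ^+ k.+1 = t + mu a ^+ k &
      injective (fun a => mu a ^+ n)].
Proof.
pose h (z : F) := z ^+ k * (z - 1).
have [rs rsE] := closed_field_poly_normal ('X^n - 1 : {poly F}).
(* [h z = t] at a double root only if z = k / (k + 1), and at a root z such that
   [w * z] is also a root, w^n = 1, only if z = (1 - w^k) / (1 - w^(k+1)). *)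
pose bad := 0 :: h (k%:R / k.+1%:R) ::
  [seq h ((1 - z ^+ k) / (1 - z ^+ k.+1)) | z <- rs].
have [t] := exists_notin bad.
rewrite !inE !negb_or => /and3P[t0 tdouble tbad].
pose p : {poly F} := 'X^(k.+1) - 'X^k - t%:P.
pose q : {poly F} := 'X^k + t%:P.
have sq : (size q < k.+2)%N.
  rewrite (leq_ltn_trans (size_polyD _ _)) // gtn_max size_polyXn ltnS leqnn /=.
  by rewrite (leq_ltn_trans (size_polyC_leq1 _)).
have sp : size p = k.+2.
  by rewrite /p -addrA -opprD -/q size_polyDl ?size_polyN size_polyXn.
have pm : p \is monic.
  by rewrite /p -addrA -opprD -/q monicE lead_coefDl ?size_polyN ?size_polyXn // lead_coefXn.
have [mu pE] := closed_field_split pm sp.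
have muE a : mu a ^+ k.+1 = t + mu a ^+ k.
  have : p.[mu a] = 0.
    by rewrite pE horner_prod (bigD1 a) //= hornerXsubC subrr mul0r.
  rewrite /p !hornerE => /eqP; rewrite subr_eq0 subr_eq => /eqP.
  by [].
have hmu a : h (mu a) = t by rewrite /h mulrBr mulr1 -exprSr muE addrK.
have mu0 a : mu a != 0.
  apply: contraNneq t0 => m0; rewrite -(hmu a) /h m0 expr0n.
  by case: (k) hk => // ? _; rewrite mul0r.
exists t, mu; split=> // a b /= ab; apply/eqP; apply/negPn/negP => a_b.
(* Either the two roots coincide, so the derivative of [p] vanishes there, or their ratio is an
   [n]-th root of unity other than 1. *)
have [mab|mab] := eqVneq (mu a) (mu b).
  have := multiple_root pE a_b mab; rewrite /p !derivE !hornerE.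
  move=> E; case/negP: tdouble; rewrite -(hmu a); apply/eqP; congr h.
  apply: (mulIf (_ : k.+1%:R != 0)); first by rewrite pnatr_eq0.
  rewrite divfK ?pnatr_eq0 //.
  move: E; rewrite !hornerMn !hornerXn subr0.
  rewrite -[X in X - _]mulr_natr -[X in _ - X]mulr_natr => E.
  apply: (mulfI (expf_neq0 k.-1 (mu0 a))); apply/eqP; rewrite -subr_eq0 -[X in _ == X]E.
  have -> : (k.+1.-1 = k.-1.+1)%N by lia.
  by rewrite exprS mulrCA mulrA.
pose z := mu b / mu a.
have zn : z ^+ n = 1 by rewrite expr_div_n ab divff // expf_neq0.
have z1 : z != 1.
  by apply: contraNneq mab => z1; rewrite -[mu b](divfK (mu0 a)) -/z z1 mul1r.
have zE : mu a * (1 - z ^+ k.+1) = 1 - z ^+ k.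
  have bE : mu b = z * mu a by rewrite divfK.
  apply: (mulfI (expf_neq0 k (mu0 a))); apply/eqP; rewrite -subr_eq0.
  have -> : mu a ^+ k * (mu a * (1 - z ^+ k.+1)) - mu a ^+ k * (1 - z ^+ k) =
      (mu a ^+ k.+1 - mu a ^+ k) - ((z * mu a) ^+ k.+1 - (z * mu a) ^+ k).
    by rewrite !exprMn !exprS; ring.
  by rewrite -bE !muE !addrK subrr.
(* Otherwise [z ^+ k] and [z ^+ k.+1] would both be 1, forcing [z = 1]. *)
have zk : 1 - z ^+ k.+1 != 0.
  apply: contraNneq z1 => zk; move: zE; rewrite zk mulr0 => /esym/eqP.
  rewrite subr_eq0 eq_sym => /eqP zk1; move/eqP: zk.
  by rewrite exprS zk1 mulr1 subr_eq0 eq_sym.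
case/negP: tbad; apply/mapP; exists z.
  rewrite -root_prod_XsubC.
  have : root ('X^n - 1) z by rewrite /root !hornerE zn subrr.
  by rewrite rsE rootZ ?lead_coef_eq0 // -size_poly_eq0 size_XnsubC.
by rewrite -zE mulfK // hmu.
Qed.

End Witness.


(** * A nonzero polynomial in the coordinates that certifies genericity *)

Section GenericPoint.

Variables (R : realType) (k n : nat).
Hypotheses (hk : (1 < k)%N) (hn : (0 < n)%N).
Notation C := R[i].
Notation A := {mpoly C[n + n]}.

Definition point (xy : xy_space R n) : 'I_(n + n) -> C :=
  fun j => row_mx xy.1 xy.2 0 j.

Definition coord_x (i : int) : A := 'X_(lshift n (residue hn i)).
Definition coord_y (i : int) : A := 'X_(rshift n (residue hn i)).

Lemma eval_coord_x xy i : meval (point xy) (coord_x i) = periodic xy.1 i.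
Proof. by rewrite mevalXU /point row_mxEl -periodicE. Qed.

Lemma eval_coord_y xy i : meval (point xy) (coord_y i) = periodic xy.2 i.
Proof. by rewrite mevalXU /point row_mxEr -periodicE. Qed.

Definition point_x (xy : xy_space R n) (i : nat) : C := periodic xy.1 i%:Z.
Definition point_y (xy : xy_space R n) (i : nat) : C := periodic xy.2 (i%:Z - 1).

(** [norm_at_eigenvalues] is applied over the polynomial ring in the coordinates, with formal
    eigenvalues in [G] and evaluation at [xy] as the specialization. *)
Lemma generic_norm (e : 'cV[C]_k.+1) : exists P : A, forall xy lam,
  char_poly (forward_monodromy k n (point_x xy) (point_y xy)) = \prod_a ('X - (lam a)%:P) ->
  meval (point xy) P =
    \prod_(s : 'S_k.+1) genericity n (point_x xy) (point_y xy) (fun a => lam (s a)) e.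
Proof.
pose X (i : nat) : A := coord_x i%:Z; pose Y (i : nat) : A := coord_y (i%:Z - 1).
pose G : {mpoly A[k.+1]} := genericity n (fun i => (X i)%:MP) (fun i => (Y i)%:MP)
  (fun a => 'X_a) (map_mx (@mpolyC k.+1 A \o @mpolyC (n + n) C) e).
have [P PE] := norm_at_eigenvalues (forward_monodromy k n X Y) G.
exists P => xy lam lamE.
have eX : meval (point xy) \o X = point_x xy.
  by apply/funext => i; rewrite /= eval_coord_x.
have eY : meval (point xy) \o Y = point_y xy.
  by apply/funext => i; rewrite /= eval_coord_y.
rewrite (PE _ (meval (point xy)) lam); last first.
  by rewrite map_forward_monodromy eX eY.
apply: eq_bigr => s _.
rewrite [LHS](map_genericity n (mmap (meval (point xy)) (fun a => lam (s a)))).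
rewrite (_ : _ \o (fun i => (X i)%:MP) = point_x xy); last first.
  by rewrite -eX; apply/funext => i /=; rewrite mmapC.
rewrite (_ : _ \o (fun i => (Y i)%:MP) = point_y xy); last first.
  by rewrite -eY; apply/funext => i /=; rewrite mmapC.
rewrite (_ : _ \o (fun a => 'X_a) = fun a => lam (s a)); last first.
  by apply/funext => a /=; rewrite mmapX mmap1U.
rewrite (_ : map_mx _ _ = e) //.
apply/colP => r; rewrite !mxE /=.
exact: etrans (mmapC _ _ _) (mevalC _ _).
Qed.

Lemma generic_nonzero : exists (e : 'cV[C]_k.+1) (xy : xy_space R n) lam,
  char_poly (forward_monodromy k n (point_x xy) (point_y xy)) = \prod_a ('X - (lam a)%:P) /\
  forall s : 'S_k.+1, genericity n (point_x xy) (point_y xy) (fun a => lam (s a)) e != 0.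
Proof.
have [t [mu [t0 muE mun]]] := @exists_witness C k n hk hn.
exists (\col_r \sum_a mu a ^+ r), (0, const_mx t), (fun a => mu a ^+ n).
have -> : point_x (0, const_mx t) = fun=> 0.
  by apply/funext => i; rewrite /point_x (periodicE hn) mxE.
have -> : point_y (0, const_mx t) = fun=> t.
  by apply/funext => i; rewrite /point_y (periodicE hn) mxE.
split; first exact: witness_char_poly.
move=> s; have muE' a : mu (s a) ^+ k.+1 = t + mu (s a) ^+ k by [].
have mun' : injective (fun a => mu (s a) ^+ n).
  by move=> a b /mun/perm_inj.
(* Reordered roots satisfy the same hypotheses, and the vector [e] is symmetric in them, so a single
   [e] works for every [s]. *)
have := witness_genericity hk t0 muE' mun'.
congr (genericity _ _ _ _ _ != 0); apply/colP => r; rewrite !mxE.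
by rewrite [RHS](reindex_inj (@perm_inj _ s)).
Qed.

Lemma generic_polynomial : exists2 P : A, P != 0 & forall xy, xy_eval P xy != 0 ->
  [/\ forall i, periodic xy.1 i != 0, forall i, periodic xy.2 i != 0,
     forall i, periodic xy.1 i + periodic xy.2 i != 0 &
     exists (e : 'cV[C]_k.+1) lam,
       char_poly (forward_monodromy k n (point_x xy) (point_y xy)) = \prod_a ('X - (lam a)%:P) /\
       genericity n (point_x xy) (point_y xy) lam e != 0].
Proof.
have [e [xy0 [lam0 [lam0E g0]]]] := generic_nonzero.
have [P PE] := generic_norm e.
pose S : A := \prod_(i < n) (coord_x i%:Z * coord_y i%:Z * (coord_x i%:Z + coord_y i%:Z)).
have SE xy : meval (point xy) S = \prod_(i < n) (periodic xy.1 i%:Z *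
    periodic xy.2 i%:Z * (periodic xy.1 i%:Z + periodic xy.2 i%:Z)).
  rewrite rmorph_prod; apply: eq_bigr => i _.
  by rewrite !rmorphM rmorphD /= !eval_coord_x !eval_coord_y.
exists (P * S).
  rewrite mulf_neq0 //.
    apply: contra_neq (_ : meval (point xy0) P != 0) => [->|]; first by rewrite meval0.
    by rewrite (PE _ _ lam0E); apply/prodf_neq0 => s _; apply: g0.
  (* The point used for [P] has [x = 0], where [S] vanishes, so [S] is tested at [x = y = 1]. *)
  apply: contra_neq (_ : meval (point (const_mx 1, const_mx 1)) S != 0) => [->|].
    by rewrite meval0.
  rewrite SE; apply/prodf_neq0 => i _; rewrite !(periodicE hn) !mxE !mul1r.
  by rewrite -[1 + 1]/(2%:R) pnatr_eq0.
move=> xy; rewrite /xy_eval -/(point xy) mevalM mulf_eq0 negb_or => /andP[P0].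
rewrite SE => /prodf_neq0 S0.
have H i : [/\ periodic xy.1 i != 0, periodic xy.2 i != 0 &
    periodic xy.1 i + periodic xy.2 i != 0].
  have := S0 (residue hn i) isT; rewrite !(periodicE hn) residue_nat.
  by rewrite !mulf_eq0 !negb_or => /andP[/andP[]].
split; try by move=> i; have [] := H i.
have [lam lamE] := closed_field_split (char_poly_monic _)
  (size_char_poly (forward_monodromy k n (point_x xy) (point_y xy))).
exists e, lam; split=> //; move: P0; rewrite (PE _ _ lamE) => /prodf_neq0.
move=> /(_ 1%g isT); congr (genericity _ _ _ _ _ != 0).
by apply/funext => a; rewrite perm1.
Qed.

End GenericPoint.

(** * From the genericity polynomial to the hypotheses on the fibre *)

Section Assembly.

Variables (R : realType) (k n : nat) (xy : xy_space R n).
Notation C := R[i].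
Notation K := k.+1.
Hypothesis hk : (1 < k)%N.
Variables (e : 'cV[C]_K) (lam : 'I_K -> C) (u : int -> 'rV[C]_K).
Hypotheses (recu : linrec K (periodic xy.1) (periodic xy.2) u)
  (uE : forall j : 'I_K, u (j : nat)%:Z = delta_mx 0 j).
Hypothesis gen0 : genericity n (point_x xy) (point_y xy) lam e != 0.

Let forward_solu i : forward_sol k (point_x xy) (point_y xy) i = u i%:Z.
Proof. exact: (forward_solE (ltnW hk) recu uE). Qed.

Lemma forward_monodromyE : forward_monodromy k n (point_x xy) (point_y xy) = window K u n%:Z.
Proof. by apply/row_matrixP => a; rewrite !rowK forward_solu PoszD. Qed.

Let Q := eigmx (window K u n%:Z) lam e.

Lemma genericity_facts : [/\ injective lam, Q \in unitmx,
  forall g : 'I_3 -> 'I_K, injective g -> forall i : nat, (i < n)%N ->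
    \det (rows3 (u i%:Z) (u (i%:Z + 1)) (u (i%:Z + (K%:Z - 1))) *m colsub g Q) != 0 &
  forall g : 'I_3 -> 'I_K, injective g -> forall i : nat, (i < n)%N ->
    \det (rows3 (u i%:Z) (u (i%:Z + (K%:Z - 1)))
      (u (i%:Z + (K%:Z - 1 + (K%:Z - 1)))) *m colsub g Q) != 0].
Proof.
move: gen0; rewrite /genericity forward_monodromyE -/Q mulf_eq0 negb_or => /andP[].
rewrite mulf_eq0 negb_or => /andP[/prodf_neq0 lam0 Q0] /prodf_neq0 det0.
have dets (g : 'I_3 -> 'I_K) : injective g -> forall i : nat, (i < n)%N ->
  \det (rows3 (u i%:Z) (u (i + 1)%N%:Z) (u (i + k)%N%:Z) *m colsub g Q) != 0 /\
  \det (rows3 (u i%:Z) (u (i + k)%N%:Z) (u (i + (k + k))%N%:Z) *m colsub g Q) != 0.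
  move=> gI i hi; have gE : colsub g Q = colsub (finfun g) Q.
    by apply/matrixP => r j; rewrite !mxE ffunE.
  have gb : injectiveb (finfun g).
    by apply/injectiveP => a b; rewrite !ffunE => /gI.
  have /prodf_neq0/(_ (Ordinal hi) isT) := det0 _ gb.
  by rewrite mulf_eq0 negb_or /= !forward_solu gE => /andP.
split.
- move=> a b ab; apply/eqP; apply/negPn/negP => a_b.
  have /prodf_neq0/(_ b) := lam0 a isT.
  by rewrite eq_sym a_b ab subrr eqxx => /(_ isT).
- by rewrite unitmxE unitfE.
- move=> g gI i hi; have [+ _] := dets g gI i hi.
  have -> : i%:Z + (K%:Z - 1) = (i + k)%N%:Z by lia.
  by have -> : i%:Z + 1 = (i + 1)%N%:Z by lia.
- move=> g gI i hi; have [_ +] := dets g gI i hi.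
  have -> : i%:Z + (K%:Z - 1 + (K%:Z - 1)) = (i + (k + k))%N%:Z by lia.
  by have -> : i%:Z + (K%:Z - 1) = (i + k)%N%:Z by lia.
Qed.

End Assembly.

Theorem proposition5p10 (R : realType) (k n : nat)
    (hk : (3 <= k)%N) (hkn : (k <= n)%N) :
  (exists2 P : {mpoly R[i][n + n]}, P != 0
     & forall xy : xy_space R n, xy_eval P xy != 0 ->
         (psi_fiber k xy #= `I_('C(k, 3)))%card)
  /\
  ((exists2 Q : {mpoly R[i][n + n]}, Q != 0
      & forall V : gon R 3, plane_gon k n V -> xy_eval Q (psi k n V) != 0 ->
          plane_gon k n (pentagram k V))
   /\
   (forall V : gon R 3, plane_gon k n V -> plane_gon k n (pentagram k V) ->
      psi k n (pentagram k V) = corr_map k (psi k n V))).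
Proof.
have hn : (0 < n)%N by lia.
(* From here on [k] is one less than in the statement, to match matrices of size [k.+1]. *)
case: k hk hkn => [//|k] hk _.
have hk1 : (1 < k)%N by lia.
have [P P0 PP] := @generic_polynomial R k n hk1 hn.
(* The same polynomial serves for counting the fibre and for keeping the pentagram image generic. *)
have data xy : xy_eval P xy != 0 ->
    (psi_fiber k.+1 xy #= `I_('C(k.+1, 3)))%card /\
    forall V : gon R 3, plane_gon k.+1 n V -> psi k.+1 n V = xy ->
      plane_gon k.+1 n (pentagram k.+1 V).
  move=> /PP[x0 y0 s0 [e [lam [lamE gen0]]]].
  have [u recu uE] := fundamental_exists (periodic xy.1) hk y0.
  have [lam_inj Qu ind ind'] := genericity_facts hk1 recu uE gen0.
  have TQ := eigmx_eigen e lamE; rewrite (forward_monodromyE hk1 recu uE) in TQ.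
  split; first exact: psi_fiber_card hk hn x0 y0 recu uE Qu lam_inj TQ ind.
  exact: plane_pentagram hk hn x0 y0 recu uE Qu lam_inj TQ ind' s0.
split; first by exists P => // xy /data[].
split; first by exists P => // V pV /data[_]; apply.
by move=> V; apply: psi_pentagram.
Qed.
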